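(* Let $\Omega\subset\mathbb{H}^n$ be an open convex set, let $\mathcal{P}$ be the set of all supporting hyperplanes of $\Omega$, and let $F$ be the hyperbolic Funk metric of $\Omega$. For $x\in\Omega$ and $\xi\in T_x\Omega$ let $p_{\Omega,x}$ be the Minkowski functional $$p_{\Omega,x}(\xi)=\sup_{\pi\in\mathcal{P}}\frac{\cosh d(x,T(x,\xi,\pi))}{\sinh d(x,T(x,\xi,\pi))}\,\|\xi\|,$$ or equivalently $$p_{\Omega,x}(\xi)=\sup_{\pi\in\mathcal{P}}\frac{\cosh d(x,\pi)}{\sinh d(x,\pi)}\,\langle\eta_\pi(x),\xi\rangle .$$ Then the Finsler distance induced by $p_{\Omega,x}$ coincides with the hyperbolic Funk metric $F$ on $\Omega$: for all $x,y\in\Omega$, $$F(x,y)=\inf_{\sigma}\int_a^b p_{\Omega,\sigma(t)}(\dot\sigma(t))\,dt,$$ where the infimum is over all piecewise $C^1$ curves $\sigma:[a,b]\to\Omega$ with $\sigma(a)=x$ and $\sigma(b)=y$.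
   Context: $\mathbb{H}^n$ is $n$-dimensional hyperbolic space of constant curvature $-1$ with hyperbolic distance $d$, Riemannian inner product $\langle\cdot,\cdot\rangle$ and norm $\|\cdot\|$; $d(x,\pi)$ is the distance from $x$ to the set $\pi$. A supporting hyperplane of $\Omega$ is a totally geodesic hyperplane $\pi\subset\mathbb{H}^n$ that touches $\Omega$ at a boundary point and such that $\Omega$ is contained in one of the open half-spaces bounded by $\pi$. $T(x,\xi,\pi)$ is the point where the geodesic ray starting at $x$ in the direction $\xi$ intersects $\pi$. $\eta_\pi(x)$ is the unit tangent vector at $x$ whose direction is opposite to the gradient vector of the function $d(\cdot,\pi)$ at $x$. For distinct $x,y\in\Omega$, $R(x,y)=\{\exp_x(t\xi_{xy}):t>0\}$ is the hyperbolic geodesic ray from $x$ through $y$, with $\xi_{xy}$ the unit tangent vector at $x$ of the arc-length parameterized geodesic from $x$ to $y$; if $R(x,y)$ meets $\partial\Omega$, $b(x,y)$ is the intersection point. The hyperbolic Funk metric is $F(x,y)=\log\dfrac{\sinh d(x,b(x,y))}{\sinh d(y,b(x,y))}$ if $x\neq y$ and $R(x,y)\cap\partial\Omega\neq\emptyset$, and $F(x,y)=0$ otherwise.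
   Formalization: The formulas are shown equal only when the ray meets a supporting hyperplane; F is the Finsler distance for p given by both formulas, as holds for bounded Ω or Ω = H^n. For unbounded Ω with nonempty boundary the claim is false (in a half-space F violates the triangle inequality). *)

(* Defs.v *)
From mathcomp Require Import all_boot all_order all_algebra.
From mathcomp Require Import all_classical all_reals all_analysis.

Set Implicit Arguments.
Unset Strict Implicit.
Unset Printing Implicit Defensive.

Import Order.TTheory GRing.Theory Num.Theory.
Import numFieldNormedType.Exports.

Local Open Scope classical_set_scope.
Local Open Scope ring_scope.

Section RealHyperbolicFunctions.
Context {R : realType}.

Definition cosh (t : R) : R := (expR t + expR (- t)) / 2.
Definition sinh (t : R) : R := (expR t - expR (- t)) / 2.

(* Inverse of cosh on [0, +oo[; only used at arguments >= 1. *)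
Definition arcosh (t : R) : R := ln (t + Num.sqrt (t ^+ 2 - 1)).

End RealHyperbolicFunctions.

(* H^n is the upper sheet of the hyperboloid in R^(n+1), with the Lorentz form
   - x_0 y_0 + x_1 y_1 + ... + x_n y_n. *)
Section HyperbolicSpace.
Context {R : realType} {n : nat}.
Local Notation V := 'rV[R]_n.+1.
Implicit Types (x y z xi v : V) (pi Omega : set V).

Definition lorentz x y : R :=
  \sum_(i < n) x 0 (lift ord0 i) * y 0 (lift ord0 i) - x 0 0 * y 0 0.

Definition hyperboloid : set V := [set x | lorentz x x = - 1 /\ 0 < x 0 0].

Definition tangent x : set V := [set xi | lorentz x xi = 0].

(* The Riemannian inner product at x is the restriction of the Lorentz form to
   the tangent space at x, on which it is positive definite. *)
Definition hnorm xi : R := Num.sqrt (lorentz xi xi).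

Definition hdist x y : R := arcosh (- lorentz x y).

Definition hexp x xi : V :=
  cosh (hnorm xi) *: x + (sinh (hnorm xi) / hnorm xi) *: xi.

Definition hray x xi : set V := [set hexp x (t *: xi) | t in [set t | 0 < t]].

(* xi_{xy}; for x <> y in H^n there is exactly one such vector. *)
Definition direction x y : V :=
  xget 0 [set xi | [/\ tangent x xi, hnorm xi = 1 & hexp x (hdist x y *: xi) = y]].

(* R(x, y) *)
Definition ray_through x y : set V := hray x (direction x y).

Definition hopen Omega : Prop :=
  exists2 U : set V, open U & Omega = U `&` hyperboloid.

Definition hconvex Omega : Prop := forall x y, Omega x -> Omega y ->
  forall t : R, 0 <= t <= hdist x y -> Omega (hexp x (t *: direction x y)).

(* Frontier of Omega relative to H^n (points at infinity are not included). *)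
Definition hboundary Omega : set V :=
  hyperboloid `&` closure Omega `&` closure (hyperboloid `\` Omega).

(* The totally geodesic hyperplanes of H^n are its nonempty sections by linear
   hyperplanes, i.e. those with a space-like normal vector v. *)
Definition hyperplane v : set V := [set z | hyperboloid z /\ lorentz v z = 0].

(* The other half-space bounded by the same hyperplane is halfspace (- v). *)
Definition halfspace v : set V := [set z | hyperboloid z /\ 0 < lorentz v z].

Definition supporting Omega pi : Prop :=
  hboundary Omega `&` pi !=set0 /\
  exists v, [/\ 0 < lorentz v v, pi = hyperplane v & Omega `<=` halfspace v].

(* T(x, xi, pi); meaningful when the ray meets pi. *)
Definition ray_point x xi pi : V := xget 0 (hray x xi `&` pi).

Definition dist_to x pi : R := inf [set hdist x z | z in pi].

(* g is the Riemannian gradient of f at x. *)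
Definition is_hgradient (f : V -> R) x : set V :=
  [set g | tangent x g /\ forall xi, tangent x xi ->
     is_derive (0 : R) (1 : R) (fun t : R => f (hexp x (t *: xi)))
       (lorentz g xi)].

Definition hgradient (f : V -> R) x : V := xget 0 (is_hgradient f x).

(* eta_pi(x) *)
Definition eta pi x : V :=
  let g := hgradient (dist_to ^~ pi) x in - ((hnorm g)^-1 *: g).

(* First expression of p_{Omega, x}(xi): T(x, xi, pi) only exists for the
   supporting hyperplanes pi met by the ray, so the supremum is over those; it
   is 0 when there is none. *)
Definition minkowski_ray Omega x xi : R :=
  sup [set cosh (hdist x (ray_point x xi pi)) /
           sinh (hdist x (ray_point x xi pi)) * hnorm xi |
       pi in [set pi | supporting Omega pi /\ hray x xi `&` pi !=set0]].

(* Second expression, over all supporting hyperplanes. *)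
Definition minkowski_eta Omega x xi : R :=
  sup [set cosh (dist_to x pi) / sinh (dist_to x pi) * lorentz (eta pi x) xi |
       pi in supporting Omega].

(* b(x, y) *)
Definition exit_point Omega x y : V :=
  xget 0 (ray_through x y `&` hboundary Omega).

Definition funk Omega x y : R :=
  if `[< x <> y /\ ray_through x y `&` hboundary Omega !=set0 >] then
    ln (sinh (hdist x (exit_point Omega x y)) /
        sinh (hdist y (exit_point Omega x y)))
  else 0.

(* c is C^1 on [u, v], with one-sided limits of the velocity at the endpoints;
   continuity of c on the closed interval is required in piecewise_C1. *)
Definition C1_piece (u v : R) (c : R -> V) : Prop :=
  [/\ {in `]u, v[, forall t, derivable c t 1},
      {in `]u, v[, continuous (derive1 c)},
      cvg (derive1 c @ u^'+) & cvg (derive1 c @ v^'-)].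

Definition piecewise_C1 (a b : R) (c : R -> V) : Prop :=
  {within `[a, b], continuous c} /\
  exists s : seq R, [/\ path <%R a s, last a s = b &
    forall i, (i < size s)%N -> C1_piece (nth a (a :: s) i) (nth a s i) c].

Definition finsler_dist Omega (p : V -> V -> R) x y : \bar R :=
  ereal_inf [set L | exists (a b : R) (c : R -> V),
    [/\ a < b, piecewise_C1 a b c, {in `[a, b], forall t, Omega (c t)},
        c a = x /\ c b = y &
        L = (\int[lebesgue_measure]_(t in `[a, b])
               (p (c t) (derive1 c t))%:E)%E]].

End HyperbolicSpace.

(* Main.v *)
Require Import Defs.
From mathcomp Require Import all_boot all_order all_algebra.
From mathcomp Require Import all_classical all_reals all_analysis.
From mathcomp Require Import measurable_realfun ring lra.

Set Implicit Arguments.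
Unset Strict Implicit.
Unset Printing Implicit Defensive.

Import Order.TTheory GRing.Theory Num.Theory.
Import numFieldNormedType.Exports.

Local Open Scope classical_set_scope.
Local Open Scope ring_scope.

(** In the hyperboloid model a hyperplane is the zero set of [lorentz v] for a
    spacelike vector [v].  Both expressions of the Minkowski functional are
    suprema of one family of linear forms on the tangent space,

      [funk_form v x xi = - lorentz v xi / lorentz v x],

    where [v] ranges over the normals of the supporting hyperplanes, directed
    towards [Omega].  For the first expression this is the equation satisfied by
    the time at which the ray meets the hyperplane ([hray_funk_form]), and only
    the forms larger than the norm of [xi] take part, because the others belong
    to hyperplanes that the ray misses.  For the second expression it follows
    from sinh d = lorentz v x / hnorm v, where d is the distance from [x] to the
    hyperplane ([eta_funk_form]).  A form larger than the norm dominates all the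
    forms that are not, so the two suprema agree as soon as the ray meets some
    supporting hyperplane ([minkowski_ray_eta]).

    Along a curve c, [funk_form v] evaluated at the velocity is the derivative
    of - ln (lorentz v c).  Hence the length of every curve from x to y in
    [Omega] is at least ln (lorentz v x / lorentz v y), for every supporting
    normal v ([curve_length_ge]).  If the ray from x through y leaves [Omega] at
    a boundary point b, there is a supporting hyperplane through b
    ([supporting_normal_exists], a separation theorem for the cone over
    [Omega]).  On the ray, lorentz v is proportional to sinh of the signed
    distance to b, so this lower bound is the Funk distance.  Conversely every
    supporting hyperplane met by the ray is met at b or later, so on the
    geodesic segment the density is at most the hyperbolic cotangent of the
    distance to b, whose integral is the Funk distance again
    ([finsler_dist_exit]).  If the ray stays in [Omega], it meets no supporting
    hyperplane, and the geodesic segment has length 0 ([finsler_dist_no_exit]).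

    The density t |-> p (c t) (c' t) is measurable on each smooth piece, being a
    supremum of continuous functions, hence lower semicontinuous
    ([measurable_minkowski_eta]). *)

(** * Hyperbolic functions *)

Section HyperbolicFunctions.
Context {R : realType}.
Implicit Types s t u : R.

Lemma cosh2Bsinh2 t : cosh t ^+ 2 - sinh t ^+ 2 = 1.
Proof.
by rewrite /cosh /sinh expRN; field; rewrite expR_eq0.
Qed.

Lemma cosh_gt0 t : 0 < cosh t.
Proof. by rewrite divr_gt0// addr_gt0// expR_gt0. Qed.

Lemma sinh_gt0 t : 0 < t -> 0 < sinh t.
Proof. by move=> t0; rewrite divr_gt0// subr_gt0 ltr_expR; lra. Qed.

Lemma sinh0 : sinh 0 = 0 :> R.
Proof. by rewrite /sinh oppr0 subrr mul0r. Qed.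

Lemma cosh0 : cosh 0 = 1 :> R.
Proof. by rewrite /cosh oppr0 expR0; field. Qed.

Lemma coshN t : cosh (- t) = cosh t.
Proof. by rewrite /cosh opprK addrC. Qed.

Lemma sinhN t : sinh (- t) = - sinh t.
Proof. by rewrite /sinh opprK -mulNr opprB. Qed.

Lemma sinh_gt0E t : (0 < sinh t) = (0 < t).
Proof.
apply/idP/idP => [|/sinh_gt0//]; apply: contraTT; rewrite -!leNgt => t0.
by rewrite -oppr_ge0 -sinhN mulr_ge0// subr_ge0 ler_expR; lra.
Qed.

Lemma coshD s t : cosh (s + t) = cosh s * cosh t + sinh s * sinh t.
Proof. by rewrite /cosh /sinh !opprD !expRD; field. Qed.

Lemma sinhD s t : sinh (s + t) = sinh s * cosh t + cosh s * sinh t.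
Proof. by rewrite /cosh /sinh !opprD !expRD; field. Qed.

Lemma sinhB s t : sinh (s - t) = sinh s * cosh t - cosh s * sinh t.
Proof. by rewrite sinhD coshN sinhN mulrN. Qed.

Lemma sinh_lt_cosh t : sinh t < cosh t.
Proof. by rewrite ltr_pM2r ?invr_gt0//; have := expR_gt0 (- t); lra. Qed.

Lemma arcosh_cosh t : 0 <= t -> arcosh (cosh t) = t.
Proof.
move=> t0; rewrite /arcosh.
have -> : cosh t ^+ 2 - 1 = sinh t ^+ 2 by have := cosh2Bsinh2 t; lra.
have s0 : 0 <= sinh t.
  by move: t0; rewrite le_eqVlt => /orP[/eqP<-|/sinh_gt0/ltW//]; rewrite sinh0.
rewrite sqrtr_sqr ger0_norm//.
by rewrite (_ : cosh t + _ = expR t) ?expRK// /cosh /sinh; field.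
Qed.

Lemma arcosh_gt0_arg u : 1 <= u -> 0 < u + Num.sqrt (u ^+ 2 - 1).
Proof. by move=> u1; rewrite ltr_wpDr ?sqrtr_ge0//; lra. Qed.

Lemma expR_Narcosh u : 1 <= u ->
  expR (- arcosh u) = u - Num.sqrt (u ^+ 2 - 1).
Proof.
move=> u1; have w0 := arcosh_gt0_arg u1.
rewrite expRN /arcosh lnK//; apply: (mulfI (lt0r_neq0 w0)).
rewrite divff ?lt0r_neq0// mulrC -subr_sqr sqr_sqrtr; first by ring.
by rewrite subr_ge0 expr_ge1//; lra.
Qed.

Lemma cosh_arcosh u : 1 <= u -> cosh (arcosh u) = u.
Proof.
move=> u1; rewrite /cosh expR_Narcosh// {1}/arcosh lnK; first by field.
exact: arcosh_gt0_arg.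
Qed.

Lemma sinh_arcosh u : 1 <= u -> sinh (arcosh u) = Num.sqrt (u ^+ 2 - 1).
Proof.
move=> u1; rewrite /sinh expR_Narcosh// {1}/arcosh lnK; first by field.
exact: arcosh_gt0_arg.
Qed.

Lemma ler_arcosh s t : 1 <= s -> s <= t -> arcosh s <= arcosh t.
Proof.
move=> s1 st; rewrite ler_ln ?posrE ?arcosh_gt0_arg//; last by lra.
rewrite lerD// ler_sqrt ?lerD2r ?lerXn2r ?nnegrE//; first by lra.
- by lra.
- by rewrite subr_ge0 expr_ge1//; lra.
Qed.

Lemma arcosh_ge0 u : 1 <= u -> 0 <= arcosh u.
Proof.
by move=> u1; rewrite -(arcosh_cosh (lexx 0)) cosh0 ler_arcosh.
Qed.

Global Instance is_derive_cosh t : is_derive t (1 : R) cosh (sinh t).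
Proof.
rewrite /cosh /sinh.
have -> : (fun t : R => (expR t + expR (- t)) / 2) =
          2^-1 \*: (expR + (expR \o -%R)) :> (R -> R).
  by apply/funext => z /=; rewrite /GRing.scale/= mulrC.
apply: is_derive_eq; rewrite /GRing.scale/=.
by rewrite mulrN1 mulrC.
Qed.

Global Instance is_derive_sinh t : is_derive t (1 : R) sinh (cosh t).
Proof.
rewrite /cosh /sinh.
have -> : (fun t : R => (expR t - expR (- t)) / 2) =
          2^-1 \*: (expR - (expR \o -%R)) :> (R -> R).
  by apply/funext => z /=; rewrite /GRing.scale/= mulrC.
apply: is_derive_eq; rewrite /GRing.scale/=.
by rewrite mulrN1 opprK mulrC.
Qed.

Lemma continuous_cosh : continuous (@cosh R).
Proof. by move=> t; apply/differentiable_continuous/derivable1_diffP. Qed.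

Lemma continuous_sinh : continuous (@sinh R).
Proof. by move=> t; apply/differentiable_continuous/derivable1_diffP. Qed.

End HyperbolicFunctions.

(** * The Lorentz form *)

Section LorentzForm.
Context {R : realType} {n : nat}.
Local Notation V := 'rV[R]_n.+1.
Local Notation H := (@hyperboloid R n).
Implicit Types (x y z xi v w : V) (a b : R).

Lemma lorentzC x y : lorentz x y = lorentz y x.
Proof.
by rewrite /lorentz mulrC; congr (_ - _); apply: eq_bigr => i _; rewrite mulrC.
Qed.

Lemma lorentzDl x y z : lorentz (x + y) z = lorentz x z + lorentz y z.
Proof.
rewrite /lorentz !mxE mulrDl opprD addrACA; congr (_ + _).
by rewrite -big_split; apply: eq_bigr => i _; rewrite !mxE mulrDl.
Qed.

Lemma lorentzZl a x y : lorentz (a *: x) y = a * lorentz x y.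
Proof.
rewrite /lorentz !mxE mulrBr mulrA mulr_sumr; congr (_ - _).
by apply: eq_bigr => i _; rewrite !mxE mulrA.
Qed.

Lemma lorentzDr x y z : lorentz x (y + z) = lorentz x y + lorentz x z.
Proof. by rewrite lorentzC lorentzDl !(lorentzC x). Qed.

Lemma lorentzZr a x y : lorentz x (a *: y) = a * lorentz x y.
Proof. by rewrite lorentzC lorentzZl lorentzC. Qed.

Lemma lorentzNl x y : lorentz (- x) y = - lorentz x y.
Proof. by rewrite -scaleN1r lorentzZl mulN1r. Qed.

Lemma lorentzNr x y : lorentz x (- y) = - lorentz x y.
Proof. by rewrite lorentzC lorentzNl lorentzC. Qed.

Lemma lorentz0l x : lorentz 0 x = 0.
Proof. by rewrite -(scale0r x) lorentzZl mul0r. Qed.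

Lemma lorentz0r x : lorentz x 0 = 0.
Proof. by rewrite lorentzC lorentz0l. Qed.

Definition lorentzE :=
  (lorentzDl, lorentzDr, lorentzZl, lorentzZr, lorentzNl, lorentzNr,
   lorentz0l, lorentz0r).

Lemma hyperboloid_sum x : H x ->
  \sum_(i < n) x 0 (lift ord0 i) * x 0 (lift ord0 i) = x 0 0 ^+ 2 - 1.
Proof. by move=> [+ _]; rewrite /lorentz expr2; lra. Qed.

(** Expanding the sum of the squares of x0 xi_i - xi0 x_i, and using that xi
    is orthogonal to x, exhibits the Lorentz square of xi as a sum of squares. *)
Lemma tangent_sumsq x xi : H x -> tangent x xi ->
  x 0 0 ^+ 2 * lorentz xi xi = xi 0 0 ^+ 2 +
  \sum_(i < n) (x 0 0 * xi 0 (lift ord0 i) - xi 0 0 * x 0 (lift ord0 i)) ^+ 2.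
Proof.
move=> Hx; rewrite /tangent/= /lorentz => /subr0_eq xxi.
rewrite [X in _ = _ + X](_ : _ =
  x 0 0 ^+ 2 * \sum_(i < n) xi 0 (lift ord0 i) * xi 0 (lift ord0 i)
  - 2 * x 0 0 * xi 0 0 * \sum_(i < n) x 0 (lift ord0 i) * xi 0 (lift ord0 i)
  + xi 0 0 ^+ 2 * \sum_(i < n) x 0 (lift ord0 i) * x 0 (lift ord0 i)).
  by rewrite xxi (hyperboloid_sum Hx); ring.
rewrite !mulr_sumr -sumrB -big_split/=; apply: eq_bigr => i _; ring.
Qed.

Lemma hyperboloid_neq0 x : H x -> x 0 0 != 0.
Proof. by move=> [_ /lt0r_neq0]. Qed.

Lemma tangent_ge0 x xi : H x -> tangent x xi -> 0 <= lorentz xi xi.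
Proof.
move=> Hx txi; have x0 : 0 < x 0 0 ^+ 2 by rewrite exprn_gt0//; case: Hx.
rewrite -(pmulr_rge0 _ x0) (tangent_sumsq Hx txi).
by rewrite addr_ge0 ?sqr_ge0// sumr_ge0// => i _; rewrite sqr_ge0.
Qed.

Lemma tangent_eq0 x xi : H x -> tangent x xi -> lorentz xi xi = 0 -> xi = 0.
Proof.
move=> Hx txi xi0; have := tangent_sumsq Hx txi; rewrite xi0 mulr0.
set S := \sum_(i < n) _ => /esym/eqP.
have S0 : 0 <= S by apply: sumr_ge0 => i _; rewrite sqr_ge0.
rewrite paddr_eq0 ?sqr_ge0// sqrf_eq0 => /andP[/eqP xi00 /eqP S00].
apply/rowP => j; rewrite mxE.
have [j' ->|->] := unliftP ord0 j; last exact: xi00.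
have /eqP := psumr_eq0P (fun i _ => sqr_ge0 _) S00 (i := j') isT.
rewrite sqrf_eq0 xi00 mul0r subr0 mulf_eq0 (negbTE (hyperboloid_neq0 Hx)).
by move=> /eqP.
Qed.

Lemma tangent_gt0 x xi : H x -> tangent x xi -> xi != 0 -> 0 < lorentz xi xi.
Proof.
move=> Hx txi xi0; rewrite lt_def (tangent_ge0 Hx txi) andbT.
by apply: contra xi0 => /eqP/(tangent_eq0 Hx txi)/eqP.
Qed.

Lemma tangentD x xi w : tangent x xi -> tangent x w -> tangent x (xi + w).
Proof. by rewrite /tangent/= lorentzDr => -> ->; rewrite addr0. Qed.

Lemma tangentZ a x xi : tangent x xi -> tangent x (a *: xi).
Proof. by rewrite /tangent/= lorentzZr => ->; rewrite mulr0. Qed.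

Lemma tangent_proj x y : H x -> tangent x (y + lorentz x y *: x).
Proof. by move=> [xx _]; rewrite /tangent/= !lorentzE xx; ring. Qed.

(** The space orthogonal to a point is Euclidean, so Cauchy-Schwarz holds. *)
Lemma tangent_CS x xi w : H x -> tangent x xi -> tangent x w ->
  lorentz xi w ^+ 2 <= lorentz xi xi * lorentz w w.
Proof.
move=> Hx txi tw; have [->|w0] := eqVneq w 0; first by rewrite !lorentzE; lra.
have ww := tangent_gt0 Hx tw w0.
have := tangent_ge0 Hx (tangentD (tangentZ (lorentz w w) txi)
  (tangentZ (- lorentz xi w) tw)).
rewrite !lorentzE (lorentzC w xi).
rewrite (_ : _ + _ = lorentz w w *
  (lorentz xi xi * lorentz w w - lorentz xi w ^+ 2)); last by ring.
by rewrite pmulr_rge0// subr_ge0.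
Qed.

Lemma lorentz_lt0 x y : H x -> H y -> lorentz x y < 0.
Proof.
move=> Hx Hy.
have [x0 y0] : 0 < x 0 0 /\ 0 < y 0 0 by case: Hx Hy => _ ? [].
have : 0 <= \sum_(i < n)
    (x 0 0 * y 0 (lift ord0 i) - y 0 0 * x 0 (lift ord0 i)) ^+ 2.
  by apply: sumr_ge0 => i _; rewrite sqr_ge0.
rewrite [X in 0 <= X](_ : _ =
  x 0 0 ^+ 2 * \sum_(i < n) y 0 (lift ord0 i) * y 0 (lift ord0 i)
  - 2 * x 0 0 * y 0 0 * \sum_(i < n) x 0 (lift ord0 i) * y 0 (lift ord0 i)
  + y 0 0 ^+ 2 * \sum_(i < n) x 0 (lift ord0 i) * x 0 (lift ord0 i)); last first.
  by rewrite !mulr_sumr -sumrB -big_split/=; apply: eq_bigr => i _; ring.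
rewrite (hyperboloid_sum Hx) (hyperboloid_sum Hy) /lorentz.
set S := \sum_(i < n) _ => h.
have xy : 0 < x 0 0 * y 0 0 by rewrite mulr_gt0.
have : x 0 0 * y 0 0 * (S - x 0 0 * y 0 0) < 0.
  have := exprn_gt0 2 x0; have := exprn_gt0 2 y0; lra.
by rewrite pmulr_rlt0.
Qed.

Lemma lorentz_leN1 x y : H x -> H y -> lorentz x y <= - 1.
Proof.
move=> Hx Hy; have := tangent_ge0 Hx (tangent_proj y Hx).
case: (Hx) (Hy) => xx _ [yy _]; rewrite !lorentzE xx yy (lorentzC y x).
have := lorentz_lt0 Hx Hy; nra.
Qed.

(** A unit timelike vector lies on one of the two sheets; the sign of its
    product with a point tells which. *)
Lemma hyperboloid_timelike x y :
  H x -> lorentz y y = - 1 -> lorentz x y < 0 -> H y.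
Proof.
move=> Hx yy xy; split => //; rewrite ltNge; apply/negP; rewrite le_eqVlt.
move=> /orP[/eqP y0|y0].
  move: yy; rewrite /lorentz y0 mulr0 subr0 => h.
  have : 0 <= \sum_(i < n) y 0 (lift ord0 i) * y 0 (lift ord0 i).
    by apply: sumr_ge0 => i _; rewrite -expr2 sqr_ge0.
  by rewrite h; lra.
have /(lorentz_lt0 Hx) : H (- y).
  by split; [rewrite !lorentzE opprK|rewrite mxE oppr_gt0].
by rewrite lorentzNr; lra.
Qed.

Lemma hyperboloid_comb x xi s : H x -> tangent x xi -> lorentz xi xi = 1 ->
  H (cosh s *: x + sinh s *: xi).
Proof.
move=> Hx txi xi1; case: (Hx) => xx _; apply: (hyperboloid_timelike Hx).
  rewrite !lorentzE (lorentzC xi x) txi xx xi1.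
  by have := cosh2Bsinh2 s; lra.
by rewrite !lorentzE txi xx; have := cosh_gt0 s; lra.
Qed.

End LorentzForm.

(** * Separating an open convex cone from a subspace *)

Section Separation.
Context {R : realType} {m : nat}.
Variable C : set 'rV[R]_m.
Hypothesis CD : forall x y, C x -> C y -> C (x + y).
Hypothesis CZ : forall (a : R) (x : 'rV[R]_m), 0 < a -> C x -> C (a *: x).
Hypothesis Copen : forall x u : 'rV[R]_m, C x ->
  exists2 e : R, 0 < e & forall t : R, `|t| < e -> C (x + t *: u).
Implicit Types (W : 'M[R]_m) (x y z u p : 'rV[R]_m).

(** Modulo [W], the cone [C] and its opposite are open and disjoint, so the
    segment from [u] in the first to [- p] (or [p]) in the second cannot be
    covered by them; the point where it leaves the first is in neither. *)
Lemma extend_missing_subspace W u p :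
  (forall x, C x -> ~~ (x <= W)%MS) -> C u -> ~~ (p <= W + u)%MS ->
  exists2 z : 'rV[R]_m, ~~ (z <= W)%MS & forall x, C x -> ~~ (x <= W + z)%MS.
Proof.
move=> CW Cu pWu.
pose D x := exists2 w, (w <= W)%MS & C (x + w).
have DN x : D x -> D (- x) -> False.
  move=> [w Ww Cw] [w' Ww' Cw'].
  have := CW _ (CD Cw Cw'); rewrite addrACA subrr add0r => /negP; apply.
  exact: addmx_sub.
have Dopen x v : D x -> exists2 e, 0 < e & forall t, `|t| < e -> D (x + t *: v).
  move=> [w Ww /(@Copen _ v)[e e0 Ce]]; exists e => // t te.
  by exists w => //; rewrite addrAC; exact: Ce.
(* a vector outside both D and - D can be adjoined to W *)
suff [z [zW zD zND]] : exists z : 'rV[R]_m, [/\ ~~ (z <= W)%MS, ~ D z & ~ D (- z)].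
  exists z => // x Cx; apply/negP => /sub_addsmxP[[w a]]/=.
  rewrite [a]mx11_scalar mul_scalar_mx; set c := a 0 0 => xE.
  have [c0|c0|c0] := ltgtP c 0.
  - apply: zND; exists ((- c)^-1 *: (w *m W)).
      by rewrite scalemx_sub// submxMl.
    have -> : - z + (- c)^-1 *: (w *m W) = (- c)^-1 *: x.
      rewrite xE scalerDr scalerA invrN mulNr mulVf ?lt_eqF//.
      by rewrite scaleN1r addrC.
    by apply: CZ => //; rewrite invr_gt0 oppr_gt0.
  - apply: zD; exists (c^-1 *: (w *m W)).
      by rewrite scalemx_sub// submxMl.
    have -> : z + c^-1 *: (w *m W) = c^-1 *: x.
      by rewrite xE scalerDr scalerA mulVf ?gt_eqF// scale1r addrC.
    by apply: CZ => //; rewrite invr_gt0.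
  - by move/negP: (CW _ Cx); apply; rewrite xE c0 scale0r addr0 submxMl.
wlog Dp : p pWu / D p.
  move=> wl; have [Dp|nDp] := pselect (D p); first exact: (wl p).
  have [Dp'|nDp'] := pselect (D (- p)).
    by apply: (wl (- p)) => //; rewrite eqmx_opp.
  by exists p; split => //; apply: contra pWu => pW; rewrite (submx_trans pW) ?addsmxSl.
have Du : D u by exists 0; rewrite ?sub0mx// addr0.
pose g t := (1 - t) *: u - t *: p.
have gD s t : g (s + t) = g s + t *: - (u + p).
  by apply/rowP => i; rewrite !mxE; ring.
pose S := [set t : R | 0 <= t <= 1 /\ D (g t)].
have g0 : g 0 = u by rewrite /g subr0 scale1r scale0r subr0.
have S0 : S 0 by split; rewrite ?g0// lexx ler01.
have S1 : ubound S 1 by move=> t [/andP[]].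
have supS : has_sup S by split; [exists 0|exists 1].
have ss1 : sup S <= 1 by apply: ge_sup => //; exists 0.
have ss0 : 0 <= sup S by apply: ub_le_sup => //; exists 1.
exists (g (sup S)); split.
- apply/negP => gW; move/negP: pWu; apply.
  have [s0|s0] := eqVneq (sup S) 0.
    by move/negP: (CW _ Cu); rewrite s0 g0 in gW.
  have -> : p = (sup S)^-1 *: - g (sup S) + ((1 - sup S) / sup S) *: u.
    by apply/rowP => i; rewrite !mxE; field; exact: s0.
  rewrite addmx_sub ?scalemx_sub// ?eqmx_opp ?addsmxSr//.
  by rewrite (submx_trans gW) ?addsmxSl.
- move=> Dg; have [e e0 De] := Dopen _ (- (u + p)) Dg.
  have s1 : sup S < 1.
    rewrite lt_neqAle ss1 andbT; apply/eqP => s1; move: Dg.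
    by rewrite s1 /g subrr scale0r sub0r scale1r; apply: DN.
  pose d := Num.min (e / 2) (1 - sup S).
  have d0 : 0 < d by rewrite lt_min divr_gt0//= subr_gt0.
  have : S (sup S + d).
    split; last first.
      by rewrite gD; apply: De; rewrite gtr0_norm// gt_min; apply/orP; left; lra.
    have : d <= 1 - sup S by rewrite ge_min lexx orbT.
    by move=> h; apply/andP; split; lra.
  by move=> /(ub_le_sup (ex_intro _ 1 S1)); lra.
- move=> Dg; have [e e0 De] := Dopen _ (u + p) Dg.
  have [t St st] := sup_adherent e0 supS.
  case: (St) => _ Dt; apply: (DN _ Dt).
  have -> : - g t = - g (sup S) + (t - sup S) *: (u + p).
    by apply/rowP => i; rewrite !mxE; ring.
  apply: De; rewrite distrC ger0_norm; first by lra.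
  by rewrite subr_ge0; apply: ub_le_sup => //; exists 1.
Qed.

(** A subspace missing [C] that cannot be enlarged is a hyperplane, and the
    functional vanishing on it has constant sign on the convex cone [C]. *)
Lemma cone_separation W x0 : C x0 -> (forall x, C x -> ~~ (x <= W)%MS) ->
  exists f : 'cV[R]_m, W *m f = 0 /\ forall x, C x -> 0 < (x *m f) 0 0.
Proof.
move=> Cx0; have [k] := ubnP (m - \rank W)%N; elim: k W => // k IH W Wk CW.
have [full|nfull] := boolP (row_full (W + x0)%MS); last first.
  move: nfull; rewrite -sub1mx => /row_subPn[i pW].
  have [z zW CWz] := extend_missing_subspace CW Cx0 pW.
  have WWz : (W < W + z)%MS.
    rewrite /ltmx addsmxSl; apply: contra zW; apply: submx_trans.
    exact: addsmxSr.
  have [|f [Wf Cf]] := IH (W + z)%MS _ CWz.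
    have := rank_ltmx WWz; have := rank_leq_col (W + z)%MS; move: Wk.
    rewrite !ltnS => h1 h2 h3; apply: leq_trans _ h1.
    by rewrite ltn_sub2l// (leq_trans h3).
  exists f; split => //.
  by have /submxP[E ->] := addsmxSl W z; rewrite -mulmxA Wf mulmx0.
have [K [WK /rV0Pn[j Kj]]] : exists K : 'M[R]_m, W *m K = 0 /\ x0 *m K != 0.
  by exists (cokermx W); rewrite mulmx_coker -submxE CW.
pose f := ((x0 *m K) 0 j)^-1 *: (K *m delta_mx j (0 : 'I_1)).
have Wf : W *m f = 0 by rewrite -scalemxAr mulmxA WK mul0mx scaler0.
have x0f : (x0 *m f) 0 0 = 1.
  by rewrite -scalemxAr mulmxA -colE mxE [X in _ * X]mxE mulVf.
exists f; split => // y Cy; rewrite ltNge; apply/negP => yf.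
have /sub_addsmxP[[w a]]/= : (y <= W + x0)%MS by rewrite submx_full.
rewrite [a]mx11_scalar mul_scalar_mx; set c := a 0 0 => yE.
have cE : (y *m f) 0 0 = c.
  by rewrite yE mulmxDl -mulmxA Wf mulmx0 add0r -scalemxAl mxE x0f mulr1.
suff : C (w *m W) by move/CW/negP; apply; exact: submxMl.
have -> : w *m W = y + (- c) *: x0 by rewrite yE scaleNr addrK.
rewrite cE le_eqVlt in yf; case/orP: yf => [/eqP->|c0].
  by rewrite oppr0 scale0r addr0.
by apply: CD => //; apply: CZ => //; rewrite oppr_gt0.
Qed.

End Separation.

(** * Geodesics *)

Section Geodesics.
Context {R : realType} {n : nat}.
Local Notation V := 'rV[R]_n.+1.
Local Notation H := (@hyperboloid R n).
Implicit Types (x y z xi v w : V) (a b s t : R).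

Lemma hnormZ a xi : hnorm (a *: xi) = `|a| * hnorm xi.
Proof.
by rewrite /hnorm lorentzZl lorentzZr mulrA -expr2 sqrtrM ?sqr_ge0// sqrtr_sqr.
Qed.

Lemma hnorm_ge0 xi : 0 <= hnorm xi.
Proof. exact: sqrtr_ge0. Qed.

Lemma hnorm0 : hnorm (0 : V) = 0.
Proof. by rewrite /hnorm lorentz0l sqrtr0. Qed.

Lemma hnorm1P xi : hnorm xi = 1 -> lorentz xi xi = 1.
Proof.
rewrite /hnorm => h; rewrite -(@sqr_sqrtr _ (lorentz xi xi)) ?h ?expr1n//.
by rewrite leNgt; apply/negP => /ltW/ler0_sqrtr; rewrite h => /eqP; rewrite oner_eq0.
Qed.

Lemma hexpZ x xi t :
  hexp x (t *: xi) = cosh (t * hnorm xi) *: x + (sinh (t * hnorm xi) / hnorm xi) *: xi.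
Proof.
rewrite /hexp hnormZ scalerA.
have [->|h0] := eqVneq (hnorm xi) 0.
  by rewrite !mulr0 invr0 !mulr0 mul0r.
have [t0|t0|->] := ltgtP t 0.
- rewrite ltr0_norm// mulNr coshN sinhN; congr (_ + _ *: _).
  by field; rewrite h0 lt_eqF.
- rewrite gtr0_norm//; congr (_ + _ *: _).
  by field; rewrite h0 gt_eqF.
- by rewrite normr0 !mul0r sinh0 mulr0 mul0r.
Qed.

Lemma hexp_unit x xi t : hnorm xi = 1 ->
  hexp x (t *: xi) = cosh t *: x + sinh t *: xi.
Proof. by move=> h; rewrite hexpZ h mulr1 divr1. Qed.

Lemma hexp0 x : hexp x 0 = x.
Proof. by rewrite /hexp hnorm0 cosh0 scale1r scaler0 addr0. Qed.

Lemma tangent_hnorm_gt0 x xi : H x -> tangent x xi -> xi != 0 -> 0 < hnorm xi.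
Proof. by move=> Hx txi xi0; rewrite sqrtr_gt0 (tangent_gt0 Hx txi). Qed.

Lemma sqr_hnorm x xi : H x -> tangent x xi -> hnorm xi ^+ 2 = lorentz xi xi.
Proof. by move=> Hx txi; rewrite sqr_sqrtr// (tangent_ge0 Hx txi). Qed.

Lemma hexp_hyperboloid x xi : H x -> tangent x xi -> H (hexp x xi).
Proof.
move=> Hx txi; have [->|xi0] := eqVneq xi 0; first by rewrite hexp0.
have h0 := tangent_hnorm_gt0 Hx txi xi0.
rewrite /hexp -scalerA; apply: hyperboloid_comb => //; first exact: tangentZ.
by rewrite !lorentzE -(sqr_hnorm Hx txi); field; rewrite gt_eqF.
Qed.

Lemma hdist_unit x xi t : H x -> tangent x xi -> hnorm xi = 1 -> 0 <= t ->
  hdist x (hexp x (t *: xi)) = t.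
Proof.
move=> [xx _] txi xi1 t0; rewrite hexp_unit// /hdist !lorentzE xx txi.
by rewrite mulr0 addr0 mulrN1 opprK arcosh_cosh.
Qed.

Lemma cosh_hdist x y : H x -> H y -> cosh (hdist x y) = - lorentz x y.
Proof.
by move=> Hx Hy; rewrite cosh_arcosh//; have := lorentz_leN1 Hx Hy; lra.
Qed.

Lemma hdist_ge0 x y : H x -> H y -> 0 <= hdist x y.
Proof.
by move=> Hx Hy; rewrite arcosh_ge0//; have := lorentz_leN1 Hx Hy; lra.
Qed.

Lemma hdist_gt0 x y : H x -> H y -> x <> y -> 0 < hdist x y.
Proof.
move=> Hx Hy xy; rewrite lt_def hdist_ge0// andbT; apply/eqP => d0.
have := cosh_hdist Hx Hy; rewrite d0 cosh0 => lxy.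
have := tangent_eq0 Hx (tangent_proj y Hx).
case: (Hx) (Hy) => xx _ [yy _]; rewrite !lorentzE xx yy (lorentzC y x).
have -> : lorentz x y = - 1 by lra.
move=> h; apply: xy; apply/esym/eqP; rewrite -subr_eq0 -scaleN1r h//.
ring.
Qed.

Lemma directionP x y : H x -> H y -> x <> y ->
  [/\ tangent x (direction x y), hnorm (direction x y) = 1 &
      hexp x (hdist x y *: direction x y) = y].
Proof.
move=> Hx Hy xy.
suff : exists xi, [set xi | [/\ tangent x xi, hnorm xi = 1 &
    hexp x (hdist x y *: xi) = y]] xi by apply: xgetPex.
set d := hdist x y; have d0 : 0 < d by exact: hdist_gt0.
have s0 := sinh_gt0 d0; have dE := cosh_hdist Hx Hy.
case: (Hx) (Hy) => xx _ [yy _].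
pose xi := (sinh d)^-1 *: (y - cosh d *: x).
have xi1 : hnorm xi = 1.
  rewrite /hnorm /xi !lorentzE xx yy (lorentzC y x).
  have -> : lorentz x y = - cosh d by rewrite dE opprK.
  rewrite [X in Num.sqrt X](_ : _ = (sinh d ^+ 2)^-1 * (cosh d ^+ 2 - 1)).
    have -> : cosh d ^+ 2 - 1 = sinh d ^+ 2 by have := cosh2Bsinh2 d; lra.
    by rewrite mulVf ?sqrtr1// expf_neq0// gt_eqF.
  by field; rewrite gt_eqF.
exists xi; split => //.
- by rewrite /tangent/= !lorentzE xx dE; ring.
- rewrite hexp_unit// /xi scalerA divff ?gt_eqF// scale1r addrC subrK//.
Qed.

(** Restarting a geodesic at one of its points: facts about rays from [x] thus
    apply at every point of the segment. *)
Lemma geodesic_shift x xi s t :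
  let c r := cosh r *: x + sinh r *: xi in
  let c' r := sinh r *: x + cosh r *: xi in
  c (s + t) = cosh t *: c s + sinh t *: c' s.
Proof.
by move=> c c'; rewrite /c /c' coshD sinhD; apply/rowP => i; rewrite !mxE; ring.
Qed.

Lemma geodesic_velocity x xi s : H x -> tangent x xi -> hnorm xi = 1 ->
  let c := cosh s *: x + sinh s *: xi in
  let c' := sinh s *: x + cosh s *: xi in
  [/\ H c, tangent c c' & hnorm c' = 1].
Proof.
move=> Hx txi xi1 c c'; have l1 := hnorm1P xi1; case: (Hx) => xx _.
have := cosh2Bsinh2 s => CS.
split; first exact: hyperboloid_comb.
- by rewrite /tangent/= !lorentzE (lorentzC xi x) xx txi l1; ring.
- rewrite /hnorm !lorentzE (lorentzC xi x) xx txi l1.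
  by rewrite [X in Num.sqrt X](_ : _ = 1) ?sqrtr1//; lra.
Qed.

End Geodesics.

(** * Supporting hyperplanes *)

Section SupportingHyperplanes.
Context {R : realType} {n : nat}.
Local Notation V := 'rV[R]_n.+1.
Local Notation H := (@hyperboloid R n).
Implicit Types (x y z xi v w u : V) (a b s t : R) (Omega : set V).

Lemma hopen_subset Omega : hopen Omega -> Omega `<=` H.
Proof. by move=> [U _ ->] x []. Qed.

Lemma hopen_near Omega (f : R -> V) t0 : hopen Omega -> {for t0, continuous f} ->
  (\forall t \near t0, H (f t)) -> Omega (f t0) -> \forall t \near t0, Omega (f t).
Proof.
move=> [U Uo ->] cf Hf [Uf _].
have nU : \forall t \near t0, U (f t) by apply: cf; exact: open_nbhs_nbhs.
by apply: filterS2 nU Hf => t.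
Qed.

Lemma hopen_near_line Omega x u : hopen Omega -> Omega x ->
  \forall t \near (0 : R), exists2 k : R, 0 < k & Omega (k *: (x + t *: u)).
Proof.
move=> oO Ox; have Hx := hopen_subset oO Ox; case: (Hx) => xx _.
pose q t : R := 1 - 2 * t * lorentz x u - t * t * lorentz u u.
have qE t : lorentz (x + t *: u) (x + t *: u) = - q t.
  by rewrite !lorentzE xx (lorentzC u x) /q; ring.
pose f t := (Num.sqrt (q t))^-1 *: (x + t *: u).
have cq : {for 0, continuous q}.
  rewrite /q; apply: cvgB; first apply: cvgB.
  - exact: cvg_cst.
  - apply: cvgM; last exact: cvg_cst.
    by apply: cvgM; [exact: cvg_cst|exact: cvg_id].
  - apply: cvgM; last exact: cvg_cst.
    by apply: cvgM; exact: cvg_id.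
have q0 : q 0 = 1 by rewrite /q; ring.
have f0 : f 0 = x by rewrite /f q0 sqrtr1 invr1 scale1r scale0r addr0.
have nq : \forall t \near (0 : R), 0 < q t.
  by apply: (cvgr_gt (q 0) cq); rewrite q0.
have nx : \forall t \near (0 : R), t * lorentz x u < 1.
  have cx : t * lorentz x u @[t --> (0 : R)] --> 0 * lorentz x u.
    by apply: cvgM; [exact: cvg_id|exact: cvg_cst].
  by apply: (cvgr_lt _ cx); rewrite mul0r.
have cf : {for 0, continuous f}.
  rewrite /f; apply: cvgZ.
    apply: cvgV; first by rewrite q0 sqrtr1 oner_eq0.
    apply: (@continuous_comp _ _ _ q Num.sqrt) => //; exact: sqrt_continuous.
  apply: cvgD; first exact: cvg_cst.
  by apply: cvgZ; [exact: cvg_id|exact: cvg_cst].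
have nH : \forall t \near (0 : R), H (f t).
  apply: filterS2 nq nx => t qt xt; have s0 : 0 < Num.sqrt (q t) by rewrite sqrtr_gt0.
  apply: (hyperboloid_timelike Hx).
    rewrite /f !(lorentzZl, lorentzZr) qE -{3}(sqr_sqrtr (ltW qt)).
    by field; rewrite gt_eqF.
  rewrite /f lorentzZr pmulr_rlt0 ?invr_gt0// !lorentzE xx; lra.
have := hopen_near oO cf nH; rewrite f0 => /(_ Ox) nO.
apply: filterS2 nq nO => t qt Oft.
by exists (Num.sqrt (q t))^-1 => //; rewrite invr_gt0 sqrtr_gt0.
Qed.

(** The convex combinations of two points fill, up to scaling, the geodesic
    segment between them: the intermediate value theorem finds the time at
    which the geodesic crosses a given ray. *)
Lemma hconvex_comb Omega x y a b : hopen Omega -> hconvex Omega ->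
  Omega x -> Omega y -> 0 < a -> 0 < b ->
  exists2 k : R, 0 < k & Omega (k *: (a *: x + b *: y)).
Proof.
move=> oO cO Ox Oy a0 b0; have [xy|xy] := pselect (x = y).
  exists (a + b)^-1; first by rewrite invr_gt0 addr_gt0.
  by rewrite -xy -scalerDl scalerA mulVf ?scale1r// gt_eqF// addr_gt0.
have [Hx Hy] := (hopen_subset oO Ox, hopen_subset oO Oy).
have [txi xi1] := directionP Hx Hy xy; set xi := direction x y in txi xi1 *.
have L0 := hdist_gt0 Hx Hy xy; set L := hdist x y in L0 *.
rewrite (hexp_unit _ _ xi1) => yE; have sL := sinh_gt0 L0.
pose A := a + b * cosh L; pose B := b * sinh L.
have A0 : 0 < A by rewrite addr_gt0// mulr_gt0// cosh_gt0.
pose h t := A * sinh t - B * cosh t.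
have ch : continuous h.
  move=> t; rewrite /h; apply: cvgB; apply: cvgM; try exact: cvg_cst.
    exact: continuous_sinh.
  exact: continuous_cosh.
have h0 : h 0 < 0 by rewrite /h sinh0 cosh0 mulr0 mulr1 sub0r oppr_lt0 mulr_gt0.
have hL : 0 < h L.
  have -> : h L = a * sinh L by rewrite /h /A /B; ring.
  exact: mulr_gt0.
have [|t tL ht] := IVT (v := 0) (ltW L0) (continuous_subspaceT ch).
  by rewrite ge_min le_max (ltW h0) (ltW hL) orbT.
exists (cosh t / A); first by rewrite divr_gt0// cosh_gt0.
have := cO _ _ Ox Oy t; rewrite (hexp_unit _ _ xi1); move: tL; rewrite in_itv/= => tL.
move=> /(_ tL); congr Omega; rewrite -yE.
have -> : sinh t = cosh t / A * B.
  move/eqP: ht; rewrite subr_eq0 => /eqP h1.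
  by rewrite mulrAC -[cosh t * B]mulrC -h1; field; rewrite gt_eqF.
apply/rowP => i; rewrite !mxE /B.
have -> : cosh t * x 0 i = cosh t / A * (a + b * cosh L) * x 0 i.
  by rewrite /A; field; rewrite gt_eqF.
ring.
Qed.

(** In the ambient vector space the points of [Omega] span an open convex cone,
    and a point [z] of the hyperboloid outside [Omega] spans a line that misses
    it.  A linear hyperplane through this line separates the two, and its
    normal vector is spacelike because it is orthogonal to [z]. *)
Lemma supporting_normal_exists Omega x0 z : hopen Omega -> hconvex Omega ->
  Omega x0 -> H z -> ~ Omega z ->
  exists v, [/\ 0 < lorentz v v, lorentz v z = 0 & Omega `<=` halfspace v].
Proof.
move=> oO cO Ox0 Hz Oz.
pose C : set V := [set y | exists2 k : R, 0 < k & Omega (k *: y)].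
have CZ (a : R) y : 0 < a -> C y -> C (a *: y).
  move=> a0 [k k0 Oy]; exists (k / a); first by rewrite divr_gt0.
  by rewrite scalerA divfK// gt_eqF.
have CO y : Omega y -> C y by exists 1; rewrite ?scale1r.
have CD y w : C y -> C w -> C (y + w).
  move=> [a a0 Oy] [b b0 Ow].
  have [||k k0] := hconvex_comb (a := a^-1) (b := b^-1) oO cO Oy Ow.
  - by rewrite invr_gt0.
  - by rewrite invr_gt0.
  by rewrite !scalerA !mulVf ?gt_eqF// !scale1r; exists k.
have Copen y u : C y -> exists2 e : R, 0 < e & forall t, `|t| < e -> C (y + t *: u).
  move=> [a a0 Oy]; have /nbhs_ballP[e /= e0 He] := hopen_near_line (a *: u) oO Oy.
  exists e => // t te; have [|k k0] := He t.
    by rewrite /ball/= sub0r normrN.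
  rewrite scalerA (mulrC t) -scalerA -scalerDr => Ok.
  by exists (k * a); rewrite ?mulr_gt0// -scalerA.
have Cz y : C y -> ~~ (y <= <<z>>)%MS.
  move=> [k k0 Oy]; apply/negP; rewrite genmxE => /sub_rVP[c yE].
  rewrite yE scalerA in Oy; have [kczz kcz] := hopen_subset oO Oy.
  move: kczz; case: (Hz) => zz z0; rewrite !lorentzE zz => kc.
  have kc0 : 0 < k * c by move: kcz; rewrite mxE pmulr_lgt0.
  have kc1 : k * c = 1 by nra.
  by apply: Oz; move: Oy; rewrite kc1 scale1r.
have [f [zf Cf]] := cone_separation CD CZ Copen (CO _ Ox0) Cz.
pose v : V := \row_j (if j == ord0 then - f ord0 0 else f j 0).
have vE y : lorentz v y = (y *m f) 0 0.
  rewrite [RHS]mxE big_ord_recl /lorentz addrC; congr (_ + _).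
    by rewrite mxE eqxx; ring.
  by apply: eq_bigr => i _; rewrite !mxE/= mulrC.
have vz : lorentz v z = 0.
  have /submxP[D zD] : (z <= <<z>>)%MS by rewrite genmxE.
  by rewrite vE zD -mulmxA zf mulmx0 mxE.
have vO y : Omega y -> 0 < lorentz v y by move=> /CO/Cf; rewrite vE.
exists v; split => //.
  apply: (tangent_gt0 Hz); first by rewrite /tangent/= lorentzC.
  by apply/eqP => v0; have := vO _ Ox0; rewrite v0 lorentz0l ltxx.
by move=> y Oy; split; [exact: hopen_subset Oy|exact: vO].
Qed.

Lemma continuous_lorentz v : continuous (lorentz v : V -> R).
Proof.
move=> x.
have cM i : (fun y : V => v 0 i * y 0 i) @ x --> v 0 i * x 0 i.
  by apply: (@cvgM _ _ (nbhs x)); [exact: cvg_cst|exact: coord_continuous].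
apply: (@cvgB _ _ _ (nbhs x) _
  (fun y : V => \sum_(i < n) v 0 (lift ord0 i) * y 0 (lift ord0 i))).
  by apply: (cvg_big (@add_continuous R)) => i _; exact: cM.
exact: cM.
Qed.

Lemma halfspace_closure Omega v z : Omega `<=` halfspace v -> closure Omega z ->
  0 <= lorentz v z.
Proof.
move=> Ov; rewrite leNgt => clz; apply/negP => vz.
have /clz[y [/Ov[_ vy]]] : nbhs z [set y | lorentz v y < 0].
  exact: (cvgr_lt _ (@continuous_lorentz v z)).
by rewrite /= ltNge ltW.
Qed.

Lemma hboundary_notin Omega z : hopen Omega -> hboundary Omega z -> ~ Omega z.
Proof.
move=> [U Uo ->] [_ clz] [Uz _].
have /clz[y [[Hy UHy] Uy]] : nbhs z U by exact: open_nbhs_nbhs.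
by apply: UHy.
Qed.

End SupportingHyperplanes.

(** * The two expressions of the Minkowski functional *)

Section MinkowskiFunctional.
Context {R : realType} {n : nat}.
Local Notation V := 'rV[R]_n.+1.
Local Notation H := (@hyperboloid R n).
Implicit Types (x y z xi v w u g : V) (a b s t r : R) (pi Omega : set V).

(** Along a curve [c], [funk_form v (c t) (c' t)] is the derivative of
    [- ln (lorentz v (c t))]. *)
Definition funk_form v x xi : R := - lorentz v xi / lorentz v x.

Lemma hray_funk_form x xi v z : H x -> tangent x xi -> 0 < lorentz v x ->
  (hray x xi `&` hyperplane v) z ->
  cosh (hdist x z) / sinh (hdist x z) * hnorm xi = funk_form v x xi /\
  hnorm xi < funk_form v x xi.
Proof.
move=> Hx txi vx [[t t0 <-] [_]]; rewrite /= in t0.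
have [->|xi0] := eqVneq xi 0; first
  by rewrite scaler0 hexp0 => vx0; rewrite vx0 ltxx in vx.
have h0 := tangent_hnorm_gt0 Hx txi xi0; set h := hnorm xi in h0 *.
have th0 : 0 < t * h by rewrite mulr_gt0.
have s0 := sinh_gt0 th0; case: (Hx) => xx _.
rewrite hexpZ -/h !lorentzE => vz.
have -> : hdist x (cosh (t * h) *: x + (sinh (t * h) / h) *: xi) = t * h.
  rewrite /hdist !lorentzE xx txi mulr0 addr0 mulrN1 opprK arcosh_cosh//.
  exact: ltW.
have E : cosh (t * h) / sinh (t * h) * h = funk_form v x xi.
  rewrite /funk_form.
  have -> : lorentz v xi = - (cosh (t * h) * lorentz v x * h / sinh (t * h)).
    by move: vz => /eqP; rewrite addrC addr_eq0 => /eqP vz;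
       rewrite -mulNr -mulNr -vz; field; rewrite !gt_eqF.
  by field; rewrite !gt_eqF.
split => //; rewrite -E -[ltLHS]mul1r ltr_pM2r// ltr_pdivlMr// mul1r.
exact: sinh_lt_cosh.
Qed.

Lemma hray_meets_hyperplane x xi v : H x -> tangent x xi -> 0 < lorentz v x ->
  hnorm xi < funk_form v x xi -> hray x xi `&` hyperplane v !=set0.
Proof.
move=> Hx txi vx hq.
have [xi0|xi0] := eqVneq xi 0.
  by move: hq; rewrite /funk_form xi0 lorentz0r hnorm0 oppr0 mul0r ltxx.
have h0 := tangent_hnorm_gt0 Hx txi xi0; set h := hnorm xi in h0 hq *.
(* the time is chosen so that its hyperbolic cotangent is k *)
pose k := funk_form v x xi / h.
have k1 : 1 < k by rewrite ltr_pdivlMr// mul1r.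
pose e2 := (k + 1) / (k - 1); have k10 : 0 < k - 1 by lra.
have e21 : 1 < e2 by rewrite ltr_pdivlMr//; lra.
pose e := Num.sqrt e2; have e0 : 0 < e by rewrite sqrtr_gt0; lra.
have eE : e ^+ 2 = e2 by rewrite sqr_sqrtr; lra.
have e1 : 1 < e by rewrite -(ltr_pXn2r (n := 2)) ?nnegrE ?eE ?expr1n//; lra.
pose th := ln e; have th0 : 0 < th by rewrite ln_gt0.
have vxi : lorentz v xi = - k * h * lorentz v x.
  by rewrite /k /funk_form; field; rewrite !gt_eqF.
have kE : cosh th = k * sinh th.
  rewrite /cosh /sinh expRN lnK//; apply: (mulIf (lt0r_neq0 e0)).
  apply: (@mulfI _ 2) => //.
  have : (k - 1) * e ^+ 2 = k + 1 by rewrite eE mulrC divfK// gt_eqF.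
  move=> ke; rewrite [LHS](_ : _ = e ^+ 2 + 1); last by field; rewrite gt_eqF.
  rewrite [RHS](_ : _ = k * (e ^+ 2 - 1)); last by field; rewrite gt_eqF.
  lra.
exists (hexp x ((th / h) *: xi)); split.
  by exists (th / h) => //=; rewrite divr_gt0.
split; first by apply: hexp_hyperboloid => //; exact: tangentZ.
rewrite hexpZ -/h divfK ?gt_eqF// !lorentzE vxi kE.
by field; rewrite gt_eqF.
Qed.

(** The point of a hyperplane nearest to [x] is the normalized orthogonal
    projection [w] of [x]; Cauchy-Schwarz in the tangent space at another point
    [z] of the hyperplane, where the normal vector is tangent, shows that [z]
    is at least as far. *)
Lemma dist_to_hyperplane x v : H x -> 0 < lorentz v v -> 0 < lorentz v x ->
  dist_to x (hyperplane v) =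
  arcosh (Num.sqrt (1 + (lorentz v x / hnorm v) ^+ 2)).
Proof.
move=> Hx vv vx; case: (Hx) => xx _.
set s := lorentz v x / hnorm v; set A := Num.sqrt (1 + s ^+ 2).
have s2 : s ^+ 2 = lorentz v x ^+ 2 / lorentz v v.
  by rewrite expr_div_n /hnorm sqr_sqrtr// ltW.
have s20 : 0 <= s ^+ 2 by rewrite sqr_ge0.
have A2 : A ^+ 2 = 1 + s ^+ 2 by rewrite sqr_sqrtr//; lra.
have A0 : 0 < A by rewrite sqrtr_gt0; lra.
have A1 : 1 <= A by rewrite -(@ler_pXn2r _ 2) ?nnegrE ?expr1n//; lra.
pose w := A^-1 *: (x - (lorentz v x / lorentz v v) *: v).
have xw : lorentz x w = - A.
  rewrite /w !lorentzE xx (lorentzC x v).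
  rewrite [LHS](_ : _ = - (A ^-1 * (1 + s ^+ 2))).
    by rewrite -A2; field; rewrite gt_eqF.
  by rewrite s2; field; rewrite !gt_eqF.
have Hw : H w.
  apply: (hyperboloid_timelike Hx); last by rewrite xw; lra.
  rewrite /w !lorentzE xx (lorentzC x v).
  rewrite [LHS](_ : _ = - ((A ^+ 2)^-1 * (1 + s ^+ 2))).
    by rewrite A2 mulVf// gt_eqF//; lra.
  by rewrite s2; field; rewrite !gt_eqF.
have vw : lorentz v w = 0.
  by rewrite /w !lorentzE; field; rewrite !gt_eqF.
have le_hdist z : hyperplane v z -> arcosh A <= hdist x z.
  move=> [Hz vz]; rewrite /hdist ler_arcosh//.
  have tv : tangent z v by rewrite /tangent/= lorentzC.
  have := tangent_CS Hz (tangent_proj x Hz) tv.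
  case: (Hz) => zz _; rewrite !lorentzE xx zz (lorentzC z v) vz (lorentzC z x).
  rewrite mulr0 addr0 (lorentzC x v) => CS.
  have : s ^+ 2 <= lorentz x z ^+ 2 - 1.
    by rewrite s2 ler_pdivrMr//; lra.
  move=> h; have xz := lorentz_lt0 Hx Hz.
  by rewrite -(@ler_pXn2r _ 2) ?nnegrE ?A2 ?sqrrN//; lra.
apply/eqP; rewrite eq_le; apply/andP; split.
- have -> : arcosh A = hdist x w by rewrite /hdist xw opprK.
  apply: ge_inf; last by exists w.
  by exists (arcosh A) => _ [z zv <-]; exact: le_hdist.
- by apply: lb_le_inf; [exists (hdist x w), w|move=> _ [z zv <-]; exact: le_hdist].
Qed.

Lemma arcosh_sqrt1Dsqr r : 0 <= r ->
  arcosh (Num.sqrt (1 + r ^+ 2)) = ln (Num.sqrt (1 + r ^+ 2) + r).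
Proof.
move=> r0; have r2 := sqr_ge0 r; rewrite /arcosh sqr_sqrtr; last by lra.
by rewrite [_ - 1]addrAC subrr add0r sqrtr_sqr ger0_norm.
Qed.

Lemma is_derive_arsinh r : 0 < r ->
  is_derive r (1 : R) (fun s => ln (Num.sqrt (1 + s ^+ 2) + s))
    (Num.sqrt (1 + r ^+ 2))^-1.
Proof.
move=> r0; have r2 := sqr_ge0 r.
have q0 : 0 < 1 + r ^+ 2 by lra.
set A := Num.sqrt _; have A0 : 0 < A by rewrite sqrtr_gt0.
have d1 : is_derive r (1 : R) (fun s : R => 1 + s ^+ 2) (2 * r).
  have -> : (fun s : R => 1 + s ^+ 2) = cst 1 + (@id R) ^+ 2 by apply/funext.
  by apply: is_derive_eq; rewrite add0r/= expr1 /GRing.scale/= mulr1.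
have d2 : is_derive r (1 : R) (fun s : R => Num.sqrt (1 + s ^+ 2)) (r / A).
  have := @is_derive1_comp _ Num.sqrt (fun s : R => 1 + s ^+ 2) r _ _
    (is_derive1_sqrt q0) d1.
  by move=> h; apply: (is_derive_eq h); rewrite -/A; field; rewrite gt_eqF.
have d3 : is_derive r (1 : R) (fun s : R => Num.sqrt (1 + s ^+ 2) + s) (r / A + 1).
  have -> : (fun s : R => Num.sqrt (1 + s ^+ 2) + s) =
    (fun s : R => Num.sqrt (1 + s ^+ 2)) + id by apply/funext.
  exact: is_deriveD.
have Ar : 0 < Num.sqrt (1 + r ^+ 2) + r by rewrite addr_gt0.
have := @is_derive1_comp _ (@ln R) (fun s : R => Num.sqrt (1 + s ^+ 2) + s) r _ _
  (is_derive1_ln Ar) d3.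
move=> h; apply: (is_derive_eq h); rewrite -/A in Ar *.
by field; rewrite !gt_eqF.
Qed.

Lemma is_derive_lorentz_hexp x xi v : H x -> tangent x xi ->
  is_derive (0 : R) (1 : R) (fun t => lorentz v (hexp x (t *: xi))) (lorentz v xi).
Proof.
move=> Hx txi; set h := hnorm xi.
have -> : (fun t => lorentz v (hexp x (t *: xi))) =
    (lorentz v x) \*: (@cosh R \o *%R^~ h) +
    (lorentz v xi / h) \*: (@sinh R \o *%R^~ h) :> (R -> R).
  apply/funext => t; rewrite hexpZ !lorentzE /= -/h /GRing.scale/=.
  by congr (_ + _); [rewrite mulrC|rewrite mulrC mulrA mulrAC].
have dh : is_derive (0 : R) (1 : R) ( *%R^~ h) h.
  have -> : ( *%R^~ h) = h \*: (@id R).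
    by apply/funext => t /=; rewrite /GRing.scale/= mulrC.
  by apply: is_derive_eq; rewrite /GRing.scale/= mulr1.
have dc := @is_derive1_comp _ (@cosh R) ( *%R^~ h) 0 _ _ (is_derive_cosh _) dh.
have ds := @is_derive1_comp _ (@sinh R) ( *%R^~ h) 0 _ _ (is_derive_sinh _) dh.
apply: is_derive_eq; rewrite mul0r sinh0 cosh0 mul0r mul1r scaler0 add0r.
rewrite /GRing.scale/=.
have [xi0|xi0] := eqVneq xi 0; first by rewrite xi0 lorentz0r !mul0r.
by rewrite divfK// gt_eqF// (tangent_hnorm_gt0 Hx txi).
Qed.

(** The distance to the hyperplane is the inverse hyperbolic sine of
    [lorentz v x / hnorm v]; its gradient is the tangential part of [v],
    normalized. *)
Lemma is_hgradient_dist_to x v : H x -> 0 < lorentz v v -> 0 < lorentz v x ->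
  is_hgradient (dist_to ^~ (hyperplane v)) x
    ((hnorm v * Num.sqrt (1 + (lorentz v x / hnorm v) ^+ 2))^-1 *:
     (v + lorentz v x *: x)).
Proof.
move=> Hx vv vx; set A := Num.sqrt _; case: (Hx) => xx _.
have k0 : 0 < hnorm v by rewrite sqrtr_gt0.
have vx0 : 0 < lorentz v x / hnorm v by rewrite divr_gt0.
split; first by apply: tangentZ; rewrite (lorentzC v); exact: tangent_proj.
move=> xi txi; pose S t := lorentz v (hexp x (t *: xi)) / hnorm v.
have S0 : S 0 = lorentz v x / hnorm v by rewrite /S scale0r hexp0.
have dS : is_derive (0 : R) (1 : R) S (lorentz v xi / hnorm v).
  have dl := is_derive_lorentz_hexp v Hx txi.
  have -> : S = (hnorm v)^-1 \*: (fun t => lorentz v (hexp x (t *: xi))) :> (R -> R).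
    by apply/funext => t; rewrite /S /GRing.scale/= mulrC.
  by apply: is_derive_eq; rewrite /GRing.scale/= mulrC.
have Spos : \forall t \near (0 : R), 0 < S t.
  have cS : {for 0, continuous S} by apply/differentiable_continuous/derivable1_diffP.
  by apply: (cvgr_gt _ cS); rewrite S0.
have near_arsinh : \forall t \near (0 : R),
    ln (Num.sqrt (1 + S t ^+ 2) + S t) = dist_to (hexp x (t *: xi)) (hyperplane v).
  apply: filterS Spos => t St; rewrite -arcosh_sqrt1Dsqr ?ltW//.
  rewrite dist_to_hyperplane//; first by apply: hexp_hyperboloid => //; exact: tangentZ.
  by rewrite -(pmulr_lgt0 _ (x := (hnorm v)^-1)) ?invr_gt0.
apply: (near_eq_is_derive near_arsinh).
have dA : is_derive (S 0) (1 : R) (fun s => ln (Num.sqrt (1 + s ^+ 2) + s)) A^-1.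
  by rewrite S0; exact: is_derive_arsinh.
have := @is_derive1_comp _ _ S 0 _ _ dA dS.
move=> h; apply: (is_derive_eq h); rewrite !lorentzE txi mulr0 addr0.
have A0 : 0 < A by rewrite sqrtr_gt0; have := sqr_ge0 (lorentz v x / hnorm v); lra.
by field; rewrite !gt_eqF.
Qed.

Lemma hgradient_unique (f : V -> R) x g : H x -> is_hgradient f x g ->
  hgradient f x = g.
Proof.
move=> Hx gP; rewrite /hgradient; apply: xget_unique => // g' [tg' dg'].
case: gP => tg dg; have td : tangent x (g' - g).
  by rewrite -scaleN1r; apply: tangentD => //; exact: tangentZ.
apply/eqP; rewrite -subr_eq0; apply/eqP/(tangent_eq0 Hx td).
have := dg' _ td; have := dg _ td => d1 d2.
have := @derive_val _ _ _ _ _ _ _ d1; rewrite (@derive_val _ _ _ _ _ _ _ d2).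
by rewrite [X in _ -> X = 0]lorentzDl lorentzNl => ->; rewrite subrr.
Qed.

Lemma eta_funk_form x xi v : H x -> tangent x xi -> 0 < lorentz v v ->
  0 < lorentz v x ->
  cosh (dist_to x (hyperplane v)) / sinh (dist_to x (hyperplane v)) *
    lorentz (eta (hyperplane v) x) xi = funk_form v x xi.
Proof.
move=> Hx txi vv vx; case: (Hx) => xx _.
rewrite dist_to_hyperplane// /eta (hgradient_unique Hx (is_hgradient_dist_to Hx vv vx)).
have k0 : 0 < hnorm v by rewrite sqrtr_gt0.
have k2 : hnorm v ^+ 2 = lorentz v v by rewrite sqr_sqrtr// ltW.
set s := lorentz v x / hnorm v; set A := Num.sqrt _.
have s0 : 0 < s by rewrite divr_gt0.
have s2 := exprn_gt0 2 s0.
have A2 : A ^+ 2 = 1 + s ^+ 2 by rewrite sqr_sqrtr//; lra.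
have A0 : 0 < A by rewrite sqrtr_gt0; lra.
have A1 : 1 <= A by rewrite -(@ler_pXn2r _ 2) ?nnegrE ?expr1n//; lra.
rewrite cosh_arcosh// sinh_arcosh// A2 [_ - 1]addrAC subrr add0r sqrtr_sqr gtr0_norm//.
have -> : hnorm ((hnorm v * A)^-1 *: (v + lorentz v x *: x)) = 1.
  rewrite hnormZ ger0_norm; last by rewrite invr_ge0 mulr_ge0// ltW.
  have -> : hnorm (v + lorentz v x *: x) = hnorm v * A.
    rewrite {1}/hnorm !lorentzE xx (lorentzC x v).
    have vxE : lorentz v x = s * hnorm v by rewrite /s divfK// gt_eqF.
    rewrite [X in Num.sqrt X](_ : _ = (hnorm v * A) ^+ 2).
      by rewrite sqrtr_sqr ger0_norm// mulr_ge0// ltW.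
    by rewrite exprMn A2 vxE -k2; ring.
  by rewrite mulVf// gt_eqF// mulr_gt0.
rewrite invr1 scale1r !lorentzE txi mulr0 addr0 /funk_form /s.
by field; rewrite !gt_eqF.
Qed.

End MinkowskiFunctional.

Section MinkowskiFormulas.
Context {R : realType} {n : nat}.
Local Notation V := 'rV[R]_n.+1.
Local Notation H := (@hyperboloid R n).
Variable Omega : set V.
Hypothesis Omega_open : hopen Omega.
Implicit Types (x y z xi v w u : V) (a b s t r : R) (pi : set V).

Definition supporting_normal : set V :=
  [set v | [/\ 0 < lorentz v v, Omega `<=` halfspace v &
               hboundary Omega `&` hyperplane v !=set0]].

Lemma supportingP pi :
  supporting Omega pi <-> exists2 v, supporting_normal v & pi = hyperplane v.
Proof.
split=> [[bpi [v [vv piE Ov]]]|[v [vv Ov bv] ->]].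
  by exists v => //; split => //; rewrite -piE.
by split => //; exists v.
Qed.

Lemma lorentz_normal_gt0 x v : Omega x -> supporting_normal v -> 0 < lorentz v x.
Proof. by move=> Ox [_ Ov _]; have [] := Ov _ Ox. Qed.

Lemma minkowski_etaE x xi : Omega x -> tangent x xi ->
  minkowski_eta Omega x xi = sup [set funk_form v x xi | v in supporting_normal].
Proof.
move=> Ox txi; have Hx := hopen_subset Omega_open Ox.
congr sup; apply/seteqP; split=> r.
  move=> [pi /supportingP[v nv ->] <-]; exists v => //.
  by rewrite eta_funk_form//; [case: nv|exact: lorentz_normal_gt0].
move=> [v nv <-]; exists (hyperplane v); first by apply/supportingP; exists v.
by rewrite eta_funk_form//; [case: nv|exact: lorentz_normal_gt0].
Qed.

Lemma minkowski_rayE x xi : Omega x -> tangent x xi ->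
  minkowski_ray Omega x xi = sup [set funk_form v x xi |
    v in [set v | supporting_normal v /\ hnorm xi < funk_form v x xi]].
Proof.
move=> Ox txi; have Hx := hopen_subset Omega_open Ox.
have rayE v : supporting_normal v -> hray x xi `&` hyperplane v !=set0 ->
    (hray x xi `&` hyperplane v) (ray_point x xi (hyperplane v)).
  by move=> nv; exact: xgetPex.
congr sup; apply/seteqP; split=> r.
  move=> [pi [/supportingP[v nv ->] /(rayE _ nv) rz] <-].
  have [-> hq] := hray_funk_form Hx txi (lorentz_normal_gt0 Ox nv) rz.
  by exists v.
move=> [v [nv hq] <-]; have vx := lorentz_normal_gt0 Ox nv.
have ne := hray_meets_hyperplane Hx txi vx hq.
exists (hyperplane v); first by split => //; apply/supportingP; exists v.
by have [] := hray_funk_form Hx txi vx (rayE _ nv ne).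
Qed.

(** A normal whose hyperplane is not met by the ray contributes at most the
    norm of [xi], less than what any normal whose hyperplane is met does. *)
Lemma minkowski_ray_eta x xi : Omega x -> tangent x xi ->
  (exists2 pi, supporting Omega pi & hray x xi `&` pi !=set0) ->
  minkowski_ray Omega x xi = minkowski_eta Omega x xi.
Proof.
move=> Ox txi [pi /supportingP[v0 nv0 ->] [z rz]].
have Hx := hopen_subset Omega_open Ox.
have [_ h0] := hray_funk_form Hx txi (lorentz_normal_gt0 Ox nv0) rz.
rewrite minkowski_rayE// minkowski_etaE//.
set A := (X in sup X = _); set B := (X in _ = sup X).
have AB : A `<=` B by move=> _ [v [nv _] <-]; exists v.
have BA r : B r -> exists2 r', A r' & r <= r'.
  move=> [v nv <-]; have [hq|qh] := ltP (hnorm xi) (funk_form v x xi).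
    by exists (funk_form v x xi) => //; exists v.
  exists (funk_form v0 x xi); first by exists v0.
  exact: le_trans qh (ltW h0).
have [[M AM]|nA] := pselect (has_ubound A); last first.
  rewrite !sup_out// => -[_ h]; apply: nA => //.
  by case: h => M BM; exists M => r /AB; exact: BM.
have A0 : A !=set0 by exists (funk_form v0 x xi), v0.
have BM : ubound B (sup A).
  move=> r /BA[r' Ar' /le_trans]; apply.
  by apply: ub_le_sup => //; exists M.
apply/eqP; rewrite eq_le; apply/andP; split.
  by apply: ge_sup => // r /AB Br; apply: ub_le_sup => //; exists (sup A).
by apply: ge_sup => //; exists (funk_form v0 x xi), v0.
Qed.

(** [Omega] contains, up to scaling, a point x + t xi with t > 0, on which
    [lorentz v] is positive for every supporting normal [v]: this bounds all the
    forms by 1 / t. *)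
Lemma funk_form_bounded x xi : Omega x ->
  has_ubound [set funk_form v x xi | v in supporting_normal].
Proof.
move=> Ox; have /nbhs_ballP[e /= e0 He] := hopen_near_line xi Omega_open Ox.
have [|k k0 Ok] := He (e / 2).
  by rewrite /ball/= sub0r normrN ger0_norm; lra.
exists (2 / e) => _ [v nv <-]; have vx := lorentz_normal_gt0 Ox nv.
have := lorentz_normal_gt0 Ok nv; rewrite lorentzZr pmulr_rgt0// !lorentzE => h.
rewrite /funk_form ler_pdivrMr// mulrAC ler_pdivlMr//; lra.
Qed.

Lemma minkowski_eta_ge x xi v : Omega x -> tangent x xi -> supporting_normal v ->
  funk_form v x xi <= minkowski_eta Omega x xi.
Proof.
move=> Ox txi nv; rewrite minkowski_etaE//; apply: ub_le_sup.
  exact: funk_form_bounded.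
by exists v.
Qed.

Lemma minkowski_ray_le x xi r : Omega x -> tangent x xi -> 0 <= r ->
  (forall v, supporting_normal v -> hnorm xi < funk_form v x xi ->
     funk_form v x xi <= r) ->
  minkowski_ray Omega x xi <= r.
Proof.
move=> Ox txi r0 ler; rewrite minkowski_rayE//; set A := (X in sup X).
have [A0|nA] := pselect (A !=set0).
  by apply: ge_sup => // _ [v [nv hq] <-]; exact: ler.
by rewrite sup_out// => -[].
Qed.

Lemma minkowski_ray_ge0 x xi : Omega x -> tangent x xi ->
  0 <= minkowski_ray Omega x xi.
Proof.
move=> Ox txi; rewrite minkowski_rayE//; set A := (X in sup X).
have [A0|nA] := pselect (A !=set0); last by rewrite sup_out// => -[].
case: (A0) => _ [v [nv hq] _].
have h : has_ubound A.
  have [M HM] := funk_form_bounded xi Ox.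
  by exists M => _ [w [nw _] <-]; apply: HM; exists w.
apply: (le_trans (hnorm_ge0 xi)); apply: (le_trans (ltW hq)).
by apply: ub_le_sup => //; exists v.
Qed.

End MinkowskiFormulas.

(** * Curves in the hyperboloid *)

Section Curves.
Context {R : realType} {n : nat}.
Local Notation V := 'rV[R]_n.+1.
Local Notation H := (@hyperboloid R n).
Implicit Types (x y z xi v w u : V) (a b s t r : R) (c : R -> V).

Lemma cvg_lorentz (T : Type) (F : set_system T) {FF : Filter F} (f g : T -> V) y z :
  f @ F --> y -> g @ F --> z ->
  (fun k => lorentz (f k) (g k)) @ F --> lorentz y z.
Proof.
move=> fy gz.
have coord (h : T -> V) (l : V) i : h @ F --> l -> (fun k => h k 0 i) @ F --> l 0 i.
  move=> hl; apply: (cvg_comp _ (fun M : V => M 0 i) hl).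
  exact: (@coord_continuous R 1 n.+1 0 i l).
have cM i : (fun k => f k 0 i * g k 0 i) @ F --> y 0 i * z 0 i.
  by apply: cvgM; exact: coord.
apply: cvgB; last exact: cM.
by apply: (cvg_big (@add_continuous R)) => i _; exact: cM.
Qed.

Lemma is_derive_lorentz c v t : derivable c t 1 ->
  is_derive t (1 : R) (fun s => lorentz v (c s)) (lorentz v (derive1 c t)).
Proof.
move=> dc; rewrite derive1E.
suff E : (fun h : R => h^-1 *: (((fun s => lorentz v (c s)) \o shift t) (h *: 1)
    - lorentz v (c t))) =
    (fun h => lorentz v (h^-1 *: ((c \o shift t) (h *: 1) - c t))).
  have cq' : h^-1 *: (((fun s => lorentz v (c s)) \o shift t) (h *: 1)
    - lorentz v (c t)) @[h --> (0 : R)^'] --> lorentz v ('D_1 c t).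
    by rewrite E; exact: (@cvg_lorentz R (0 : R)^' _ _ _ _ _ (cvg_cst v) dc).
  by apply: DeriveDef; [apply/cvg_ex; exists (lorentz v ('D_1 c t))|exact: cvg_lim cq'].
by apply/funext => h /=; rewrite lorentzZr lorentzDr lorentzNr.
Qed.

(** Where [c] has no derivative, [derive1 c] is the default value 0, which is
    tangent; elsewhere the derivative is the limit of difference quotients
    taken inside the interval, so that the end points are no exception. *)
Lemma derive1_tangent c a b t : a < b ->
  {in `[a, b], forall s, H (c s)} -> t \in `[a, b] -> tangent (c t) (derive1 c t).
Proof.
move=> ab Hc tab.
pose q h : V := h^-1 *: (c (h + t) - c t).
have [dc|ndc] := pselect (cvg (q h @[h --> 0^'])); last first.
  rewrite /derive1 (dvgP ndc) (_ : point = 0) /tangent/= ?lorentz0r//.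
  by apply/rowP => i; rewrite !mxE.
have ct : c (h + t) @[h --> 0^'] --> c t.
  have h0 : h @[h --> (0:R)^'] --> (0:R) by apply: cvg_within.
  have cs : h *: q h + c t @[h --> (0 : R)^'] --> (0 : R) *: derive1 c t + c t.
    by apply: cvgD; [exact: cvgZ|exact: cvg_cst].
  rewrite scale0r add0r in cs.
  apply: cvg_trans cs; apply: near_eq_cvg; near=> h.
  rewrite /q /= scalerA divff ?scale1r ?subrK//; near: h.
  exact: nbhs_dnbhs_neq.
have cl : lorentz (c (h + t) + c t) (q h) @[h --> (0 : R)^'] -->
    lorentz (c t + c t) (derive1 c t).
  by apply: cvg_lorentz; [apply: cvgD; [exact: ct|exact: cvg_cst]|exact: dc].
apply/eqP; apply: contraT => tc.
have {}cl : \forall h \near (0 : R)^', lorentz (c (h + t) + c t) (q h) != 0.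
  apply: (cvgr_neq0 _ cl); rewrite -mulr2n -scaler_nat lorentzZl mulf_eq0.
  by rewrite negb_or tc andbT pnatr_eq0.
have [e e0 He] : exists2 e, 0 < e &
    forall h, `|h| < e -> h != 0 -> lorentz (c (h + t) + c t) (q h) != 0.
  move: cl => /nbhs_ballP[e /= e0 He]; exists e => // h he h0; apply: He => //.
  by rewrite /ball/= sub0r normrN.
have [h [he h0 htab]] : exists h, [/\ `|h| < e, h != 0 & h + t \in `[a, b]].
  move: tab; rewrite in_itv/= => /andP[at_ tb].
  have [tb'|bt] := ltP t b.
    pose h := Num.min (e / 2) (b - t).
    have h0 : 0 < h by rewrite lt_min divr_gt0//= subr_gt0.
    have he : h <= e / 2 by rewrite ge_min lexx.
    have hb : h <= b - t by rewrite ge_min lexx orbT.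
    exists h; rewrite gt_eqF// gtr0_norm// in_itv/=; split => //; lra.
  pose h := Num.min (e / 2) (t - a).
  have h0 : 0 < h by rewrite lt_min divr_gt0//= subr_gt0; lra.
  have he : h <= e / 2 by rewrite ge_min lexx.
  have hb : h <= t - a by rewrite ge_min lexx orbT.
  exists (- h); rewrite oppr_eq0 gt_eqF// normrN gtr0_norm// in_itv/=; split => //; lra.
have := He h he h0; rewrite /q lorentzZr !lorentzE.
have [[-> _] [-> _]] := (Hc _ htab, Hc _ tab).
by rewrite (lorentzC (c t)); rewrite (_ : _ - _ + _ = 0) ?mulr0 ?eqxx//; ring.
Unshelve. all: by end_near. Qed.

(** The measurability of the density and the length estimate are both glued
    from the smooth pieces by this induction. *)
Lemma path_C1_ind (P : R -> R -> Prop) (s : seq R) a b c :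
  (forall r, P r r) ->
  (forall r1 r2 r3, a <= r1 -> r1 < r2 -> r2 <= r3 -> r3 <= b ->
     P r1 r2 -> P r2 r3 -> P r1 r3) ->
  (forall r1 r2, a <= r1 -> r1 < r2 -> r2 <= b -> C1_piece r1 r2 c -> P r1 r2) ->
  path <%R a s -> last a s = b ->
  (forall i, (i < size s)%N -> C1_piece (nth a (a :: s) i) (nth a s i) c) ->
  P a b.
Proof.
move=> Prefl Ptrans Ppiece.
have ind d : a <= d -> path <%R d s -> last d s = b ->
    (forall i, (i < size s)%N -> C1_piece (nth a (d :: s) i) (nth a s i) c) -> P d b.
  elim: s d => [|u s IH] d ad /=; first by move=> _ -> _; exact: Prefl.
  move=> /andP[du us] lb pieces.
  have ub : u <= b.
    have := mem_last u s; rewrite inE lb => /orP[/eqP->//|bs].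
    by have /allP/(_ _ bs)/ltW := order_path_min lt_trans us.
  apply: (Ptrans d u b) => //; first exact: Ppiece (pieces 0%N isT).
  apply: IH => //; first exact: le_trans (ltW du).
  by move=> i si; exact: (pieces i.+1 si).
exact: ind.
Qed.

End Curves.

(** * Length of a curve *)

Section Length.
Context {R : realType} {n : nat}.
Local Notation V := 'rV[R]_n.+1.
Local Notation H := (@hyperboloid R n).
Local Notation mu := (@lebesgue_measure R).
Variable Omega : set V.
Hypothesis Omega_open : hopen Omega.
Implicit Types (x y z xi v w u : V) (a b s t r : R) (c : R -> V).

Lemma continuous_funk_form c v t :
  {for t, continuous c} -> {for t, continuous (derive1 c)} ->
  0 < lorentz v (c t) ->
  {for t, continuous (fun s => funk_form v (c s) (derive1 c s))}.
Proof.
move=> cc cc' vc.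
have cvg_v (f : R -> V) : {for t, continuous f} ->
    lorentz v (f s) @[s --> t] --> lorentz v (f t).
  by move=> cf; apply: cvg_lorentz; [exact: cvg_cst|exact: cf].
apply: cvgM; first by apply: cvgN; exact: cvg_v.
by apply: cvgV; [rewrite gt_eqF|exact: cvg_v].
Qed.

Lemma C1_piece_continuous a b c t : C1_piece a b c -> t \in `]a, b[ ->
  {for t, continuous c} /\ {for t, continuous (derive1 c)}.
Proof.
move=> [dc cc _ _] tab; split; last exact: cc.
by apply/differentiable_continuous/derivable1_diffP; exact: dc.
Qed.

(** A supremum of continuous functions is lower semicontinuous, even when the
    supporting hyperplanes are uncountably many. *)
Lemma measurable_minkowski_eta a b c : C1_piece a b c ->
  {in `]a, b[, forall t, Omega (c t) /\ tangent (c t) (derive1 c t)} ->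
  measurable_fun `]a, b[ (fun t => minkowski_eta Omega (c t) (derive1 c t)).
Proof.
move=> pc Oc; pose N := supporting_normal Omega.
apply: (@eq_measurable_fun _ _ _ _ _
    (fun t => sup [set funk_form v (c t) (derive1 c t) | v in N])).
  by move=> t; rewrite inE/= => /Oc[Oct tct]; rewrite minkowski_etaE.
have [[v0 nv0]|nN] := pselect (N !=set0); last first.
  apply: (@eq_measurable_fun _ _ _ _ _ (cst (0 : R))); last exact: measurable_cst.
  move=> t _; rewrite /= sup_out// => -[[_ [v nv _]] _].
  by apply: nN; exists v.
move=> mD; apply: (measurability _ (RGenOInfty.measurableE R)) => //.
move=> _ [_ [r ->] <-]; apply: open_measurable; rewrite openE => t [tab].
rewrite /= in_itv/= andbT => rsup.
have [Oct tct] := Oc t tab.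
have [_ [v nv <-] rv] := sup_gt (ex_intro _ _ (ex_intro2 _ _ v0 nv0 erefl)) rsup.
have [ct ct'] := C1_piece_continuous pc tab.
have cv := continuous_funk_form ct ct' (lorentz_normal_gt0 Oct nv).
have near_ab : \forall s \near t, s \in `]a, b[ by exact: near_in_itvoo.
have near_r : \forall s \near t, r < funk_form v (c s) (derive1 c s).
  exact: (cvgr_gt _ cv).
apply: filterS2 near_ab near_r => s sab rs; split => //=.
have [Ocs tcs] := Oc s sab.
rewrite in_itv/= andbT (lt_le_trans rs)//; apply: ub_le_sup; last by exists v.
exact: (funk_form_bounded Omega_open).
Qed.

(** Integrating the form of one normal [v] along one smooth piece gives the
    variation of [- ln (lorentz v (c t))].  The fundamental theorem is applied on
    smaller compact intervals, and the end points are reached by continuity,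
    since the velocity is only known to be continuous inside the piece. *)
Lemma piece_integral_ge a b c v (f : R -> R) : a < b ->
  {within `[a, b], continuous c} -> C1_piece a b c ->
  {in `[a, b], forall t, 0 < lorentz v (c t)} ->
  measurable_fun `[a, b] f -> {in `[a, b], forall t, 0 <= f t} ->
  {in `]a, b[, forall t, funk_form v (c t) (derive1 c t) <= f t} ->
  ((ln (lorentz v (c a)) - ln (lorentz v (c b)))%:E <=
   \int[mu]_(t in `[a, b]) (f t)%:E)%E.
Proof.
move=> ab cc pc vc mf f0 fv.
pose G t := - ln (lorentz v (c t)); pose g t := funk_form v (c t) (derive1 c t).
have incl a' b' : a < a' -> b' < b -> {subset `[a', b'] <= `]a, b[}.
  move=> aa' b'b t; rewrite !in_itv/= => /andP[h1 h2]; apply/andP; split; lra.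
have oc : {subset `]a, b[ <= `[a, b]} by exact: subset_itv_oo_cc.
have dG t : t \in `]a, b[ -> is_derive t (1 : R) G (g t).
  move=> tab; have [dc _ _ _] := pc.
  have dl := is_derive_lorentz v (dc t tab).
  have := @is_derive1_comp _ (@ln R) (fun s => lorentz v (c s)) t _ _
    (is_derive1_ln (vc t (oc t tab))) dl.
  move=> /is_deriveN h; apply: (is_derive_eq h).
  by rewrite /g /funk_form mulrC mulNr.
have cg t : t \in `]a, b[ -> {for t, continuous g}.
  move=> tab; have [ct ct'] := C1_piece_continuous pc tab.
  by apply: continuous_funk_form => //; exact: vc (oc t tab).
have cvgG F t : Filter F -> t \in `[a, b] -> c s @[s --> F] --> c t ->
    G s @[s --> F] --> G t.
  move=> FF tab cF; apply: cvgN.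
  have cl : lorentz v (c s) @[s --> F] --> lorentz v (c t).
    by apply: cvg_lorentz; [exact: cvg_cst|exact: cF].
  exact: (cvg_comp _ _ cl (continuous_ln (vc t tab))).
have inner a' b' : a < a' -> a' < b' -> b' < b ->
    ((G b' - G a')%:E <= \int[mu]_(t in `[a, b]) (f t)%:E)%E.
  move=> aa' a'b' b'b.
  have sub := incl a' b' aa' b'b.
  have cG t : t \in `]a, b[ -> {for t, continuous G}.
    move=> tab; apply/differentiable_continuous/derivable1_diffP.
    by have [] := dG t tab.
  have a'ab : a' \in `]a, b[ by apply: sub; rewrite in_itv/= lexx ltW.
  have b'ab : b' \in `]a, b[ by apply: sub; rewrite in_itv/= lexx ltW.
  have cg' : {within `[a', b'], continuous g}.
    by apply: continuous_in_subspaceT => t; rewrite inE/= => /sub; exact: cg.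
  have := @continuous_FTC2 R g G a' b' a'b' cg' _ _.
  rewrite EFinB => <-; last 2 first.
  - split.
    + by move=> t tab; have [] := dG t (sub t (subset_itv_oo_cc tab)).
    + by apply: cvg_at_right_filter; exact: cG.
    + by apply: cvg_at_left_filter; exact: cG.
  - move=> t tab; rewrite derive1E.
    by apply: derive_val; exact: dG t (sub t (subset_itv_oo_cc tab)).
  have mg : measurable_fun `[a', b'] g by exact: subspace_continuous_measurable_fun.
  have mf' : measurable_fun `[a', b'] f.
    by apply: measurable_funS mf => // t; exact: (oc t \o sub t).
  apply: (@le_trans _ _ (\int[mu]_(t in `[a', b']) ((EFin \o g)^\+ t))%E).
    rewrite integralE geeDl// oppe_le0; apply: integral_ge0 => t _.
    exact: funeneg_ge0.
  apply: (@le_trans _ _ (\int[mu]_(t in `[a', b']) (f t)%:E)%E).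
    apply: ge0_le_integral => //.
    - by apply: measurable_funepos; exact/measurable_EFinP.
    - exact/measurable_EFinP.
    - move=> t tab; rewrite funeposE ge_max !lee_fin fv ?sub//=.
      by rewrite f0// oc// sub.
  apply: ge0_subset_integral => //.
  - exact/measurable_EFinP.
  - by move=> t; exact: (oc t \o sub t).
have /(continuous_within_itvP _ ab)[_ ca cb] := cc.
have aab : a \in `[a, b] by rewrite in_itv/= lexx ltW.
have bab : b \in `[a, b] by rewrite in_itv/= lexx ltW.
have Ga : G s @[s --> a^'+] --> G a by exact: cvgG.
have Gb : G s @[s --> b^'-] --> G b by exact: cvgG.
rewrite (_ : _ - _ = G b - G a); last by rewrite /G opprK addrC.
apply/lee_addgt0Pr => e e0.
have e20 : 0 < e / 2 by rewrite divr_gt0.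
have na : \forall s \near a^'+, G s < G a + e / 2 by apply: (cvgr_lt (G a) Ga); lra.
have nb : \forall s \near b^'-, G b - e / 2 < G s by apply: (cvgr_gt (G b) Gb); lra.
have [a' [Ga' aa' a'm]] : exists a', [/\ G a' < G a + e / 2, a < a' & a' < (a + b) / 2].
  near a^'+ => a'; exists a'; split; near: a'; first exact: na.
    exact: nbhs_right_gt.
  exact: nbhs_right_lt (midf_lt ab).1.
have [b' [Gb' b'b mb']] : exists b', [/\ G b - e / 2 < G b', b' < b & (a + b) / 2 < b'].
  near b^'- => b'; exists b'; split; near: b'; first exact: nb.
    exact: nbhs_left_lt.
  exact: nbhs_left_gt (midf_lt ab).2.
have a'b' : a' < b' by exact: lt_trans a'm mb'.
have := inner a' b' aa' a'b' b'b; rewrite -(leeD2rE (x := e%:E))//.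
apply: le_trans; rewrite -EFinD lee_fin; lra.
Unshelve. all: by end_near. Qed.

End Length.

Section Distance.
Context {R : realType} {n : nat}.
Local Notation V := 'rV[R]_n.+1.
Local Notation H := (@hyperboloid R n).
Local Notation mu := (@lebesgue_measure R).
Variable Omega : set V.
Hypothesis Omega_open : hopen Omega.
Variable p : V -> V -> R.
Hypothesis p_ray : forall x xi, Omega x -> tangent x xi ->
  p x xi = minkowski_ray Omega x xi.
Hypothesis p_eta : forall x xi, Omega x -> tangent x xi ->
  p x xi = minkowski_eta Omega x xi.
Implicit Types (x y z xi v w u : V) (a b s t r : R) (c : R -> V).

Lemma curve_tangent a b c : a < b -> {in `[a, b], forall t, Omega (c t)} ->
  {in `[a, b], forall t, tangent (c t) (derive1 c t)}.
Proof.
move=> ab Oc t tab; apply: (derive1_tangent ab) => // s sab.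
exact: hopen_subset Omega_open _ (Oc s sab).
Qed.

Lemma curve_density_ge0 a b c : a < b -> {in `[a, b], forall t, Omega (c t)} ->
  {in `[a, b], forall t, 0 <= p (c t) (derive1 c t)}.
Proof.
move=> ab Oc t tab; have tc := curve_tangent ab Oc tab.
by have Oct := Oc t tab; rewrite p_ray// minkowski_ray_ge0.
Qed.

Lemma curve_density_measurable a b c : a < b -> piecewise_C1 a b c ->
  {in `[a, b], forall t, Omega (c t)} ->
  measurable_fun `[a, b] (fun t => p (c t) (derive1 c t)).
Proof.
move=> ab [_ [s [ps ls pieces]]] Oc; set f := fun t => _.
pose P r1 r2 := measurable_fun `[r1, r2] f.
apply: (path_C1_ind (P := P) _ _ _ ps ls pieces).
- by move=> r; rewrite /P set_itv1; exact: measurable_fun_set1.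
- move=> r1 r2 r3 _ r12 r23 _ P12 P23; rewrite /P.
  rewrite (@itv_bndbnd_setU _ _ _ (BRight r2)) ?bnd_simp ?(ltW r12)//.
  apply/measurable_funU => //; split => //.
  by apply/measurable_fun_itv_obnd_cbndP.
- move=> r1 r2 ar1 r12 r2b pc; rewrite /P.
  apply: (@measurable_fun_itv_cc _ _ _ false true).
  have sub t : t \in `]r1, r2[ -> t \in `[a, b].
    by rewrite !in_itv/= => /andP[h1 h2]; apply/andP; split; lra.
  apply: (@eq_measurable_fun _ _ _ _ _
      (fun t => minkowski_eta Omega (c t) (derive1 c t))).
    move=> t; rewrite inE/= => /sub tab; rewrite /f p_eta//; first exact: Oc.
    exact: (curve_tangent ab Oc).
  apply: measurable_minkowski_eta => // t /sub tab; split; first exact: Oc.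
  exact: (curve_tangent ab Oc).
Qed.

Lemma curve_length_ge a b c v : a < b -> piecewise_C1 a b c ->
  {in `[a, b], forall t, Omega (c t)} -> supporting_normal Omega v ->
  ((ln (lorentz v (c a)) - ln (lorentz v (c b)))%:E <=
   \int[mu]_(t in `[a, b]) (p (c t) (derive1 c t))%:E)%E.
Proof.
move=> ab pc Oc nv.
have mf := curve_density_measurable ab pc Oc; have f0 := curve_density_ge0 ab Oc.
set f := fun t => p _ _ in mf f0 *.
case: (pc) => cc [s [ps ls pieces]].
have sub r1 r2 t : a <= r1 -> r2 <= b -> t \in `[r1, r2] -> t \in `[a, b].
  by rewrite !in_itv/= => h1 h2 /andP[h3 h4]; apply/andP; split; lra.
have subset r1 r2 : a <= r1 -> r2 <= b -> `[r1, r2] `<=` `[a, b].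
  by move=> h1 h2 t; exact: sub.
pose P r1 r2 := a <= r1 -> r2 <= b ->
  ((ln (lorentz v (c r1)) - ln (lorentz v (c r2)))%:E <=
   \int[mu]_(t in `[r1, r2]) (f t)%:E)%E.
suff : P a b by apply.
apply: (path_C1_ind (P := P) _ _ _ ps ls pieces).
- by move=> r _ _; rewrite subrr set_itv1 integral_set1.
- move=> r1 r2 r3 ar1 r12 r23 r3b P12 P23 _ _.
  have h12 := P12 ar1 (le_trans r23 r3b).
  have h23 := P23 (le_trans ar1 (ltW r12)) r3b.
  rewrite (@itv_bndbnd_setU _ _ _ (BRight r2)) ?bnd_simp ?(ltW r12)//.
  have mf13 : measurable_fun `[r1, r3] f.
    by apply: measurable_funS mf => //; exact: subset.
  have mf23 : measurable_fun `]r2, r3] (EFin \o f).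
    apply/measurable_EFinP; apply: measurable_funS mf13 => // t /=.
    by rewrite !in_itv/= => /andP[h1 h2]; apply/andP; split; lra.
  rewrite ge0_integral_setU//=; last 3 first.
  + rewrite -(@itv_bndbnd_setU _ _ _ (BRight r2)) ?bnd_simp ?(ltW r12)//.
    exact/measurable_EFinP.
  + move=> t [|]; rewrite /= in_itv/= => /andP[h1 h2]; rewrite lee_fin f0// in_itv/=;
    apply/andP; split; lra.
  + rewrite disj_set2E; apply/eqP/seteqP; split=> // t [] /=.
    by rewrite !in_itv/= => /andP[_ h1] /andP[h2 _]; lra.
  rewrite integral_itv_obnd_cbnd//.
  apply: le_trans (leeD h12 h23); rewrite -EFinD lee_fin; lra.
- move=> r1 r2 ar1 r12 r2b pr _ _; have sb := subset _ _ ar1 r2b.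
  apply: piece_integral_ge => //.
  + exact: continuous_subspaceW cc.
  + by move=> t /sb tab; apply: lorentz_normal_gt0 nv; exact: Oc.
  + exact: measurable_funS mf.
  + by move=> t /sb; exact: f0.
  + move=> t tab; have t' : t \in `[a, b] by apply: sb; exact: subset_itv_oo_cc tab.
    have tct := curve_tangent ab Oc t'.
    by have Oct := Oc t t'; rewrite /f p_eta//; apply: minkowski_eta_ge.
Qed.

(** * Geodesic rays *)

Definition geodesic x xi t : V := cosh t *: x + sinh t *: xi.

Lemma is_derive_geodesic x xi t :
  is_derive t (1 : R) (geodesic x xi) (sinh t *: x + cosh t *: xi).
Proof.
have dc := is_derive_cosh t; have ds := is_derive_sinh t.
have cq : h^-1 *: ((geodesic x xi \o shift t) (h *: 1) - geodesic x xi t)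
    @[h --> (0 : R)^'] --> sinh t *: x + cosh t *: xi.
  have [/cvg_ex[l cl] cE] := dc; have [/cvg_ex[l' cl'] sE] := ds.
  have lE : l = sinh t by rewrite -cE; apply/esym/cvg_lim.
  have lE' : l' = cosh t by rewrite -sE; apply/esym/cvg_lim.
  rewrite lE in cl; rewrite lE' in cl'.
  have -> : (fun h : R =>
      h^-1 *: ((geodesic x xi \o shift t) (h *: 1) - geodesic x xi t)) =
     (fun h : R => (h^-1 *: ((cosh \o shift t) (h *: 1) - cosh t)) *: x +
        (h^-1 *: ((sinh \o shift t) (h *: 1) - sinh t)) *: xi).
    apply/funext => h; apply/rowP => i.
    by rewrite /geodesic /= !mxE /GRing.scale/=; ring.
  by apply: cvgD; apply: cvgZ => //; exact: cvg_cst.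
by apply: DeriveDef; [apply/cvg_ex; eexists; exact: cq|exact: cvg_lim cq].
Qed.

Lemma derive1_geodesic x xi t :
  derive1 (geodesic x xi) t = sinh t *: x + cosh t *: xi.
Proof. by rewrite derive1E; apply: derive_val; exact: is_derive_geodesic. Qed.

Lemma continuous_geodesic x xi : continuous (geodesic x xi).
Proof.
move=> t; apply/differentiable_continuous/derivable1_diffP.
by have [] := is_derive_geodesic x xi t.
Qed.

Lemma continuous_derive1_geodesic x xi : continuous (derive1 (geodesic x xi)).
Proof.
have -> : derive1 (geodesic x xi) = geodesic xi x.
  by apply/funext => t; rewrite derive1_geodesic addrC.
exact: continuous_geodesic.
Qed.

Lemma C1_geodesic x xi a b : a < b -> piecewise_C1 a b (geodesic x xi).
Proof.
move=> ab; split; first by apply: continuous_subspaceT; exact: continuous_geodesic.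
exists [:: b]; split; rewrite /= ?ab//.
move=> [|//] _ /=; have cd := @continuous_derive1_geodesic x xi; split.
- by move=> t _; have [] := is_derive_geodesic x xi t.
- by move=> t _; exact: cd.
- by apply/cvg_ex; eexists; apply: cvg_at_right_filter; exact: cd.
- by apply/cvg_ex; eexists; apply: cvg_at_left_filter; exact: cd.
Qed.

(** The supremum of the times before [r] at which the ray is in [Omega] gives a
    boundary point. *)
Lemma ray_exits x xi r : Omega x -> tangent x xi -> hnorm xi = 1 -> 0 < r ->
  ~ Omega (geodesic x xi r) -> hray x xi `&` hboundary Omega !=set0.
Proof.
move=> Ox txi xi1 r0 nOr; have Hx := hopen_subset Omega_open Ox.
have l1 := hnorm1P xi1.
have Hg t : H (geodesic x xi t) by exact: hyperboloid_comb.
have near_Omega t : Omega (geodesic x xi t) ->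
    \forall s \near t, Omega (geodesic x xi s).
  move=> Ot; apply: hopen_near => //; first exact: continuous_geodesic.
  by apply: (@filterE _ (nbhs t)) => s; exact: Hg.
have g0 : geodesic x xi 0 = x by rewrite /geodesic cosh0 sinh0 scale1r scale0r addr0.
pose S := [set t | 0 <= t <= r /\ Omega (geodesic x xi t)].
have S0 : S 0 by split; rewrite ?g0// lexx ltW.
have Sr : ubound S r by move=> t [/andP[]].
have supS : has_sup S by split; [exists 0|exists r].
set m := sup S; have mr : m <= r by apply: ge_sup => //; exists 0.
have Sm t : S t -> t <= m by apply: ub_le_sup; exists r.
have m0 : 0 < m.
  rewrite -g0 in Ox; have /nbhs_ballP[e /= e0 He] := near_Omega _ Ox.
  pose d := Num.min (e / 2) r.
  have d0 : 0 < d by rewrite lt_min divr_gt0.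
  have de : d <= e / 2 by rewrite ge_min lexx.
  apply: (lt_le_trans d0); apply: Sm; split; first by rewrite ltW//= ge_min lexx orbT.
  by apply: He; rewrite /ball/= sub0r normrN gtr0_norm; lra.
exists (geodesic x xi m); split; first by exists m => //; rewrite hexp_unit.
split; first (split; first exact: Hg).
- move=> B nB.
  have /nbhs_ballP[e /= e0 He] : \forall s \near m, B (geodesic x xi s).
    exact: (@continuous_geodesic x xi m).
  have [t St tm] := sup_adherent e0 supS; exists (geodesic x xi t); split.
    by case: St.
  by apply: He; rewrite /ball/= ger0_norm ?subr_ge0 ?Sm//; rewrite -/m in tm; lra.
- move=> B nB.
  have /nbhs_ballP[e /= e0 He] : \forall s \near m, B (geodesic x xi s).
    exact: (@continuous_geodesic x xi m).
  have [rm|mr'] := leP r m.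
    have rE : r = m by apply/eqP; rewrite eq_le rm.
    exists (geodesic x xi r); split; first by split => //; exact: Hg.
    by rewrite rE; apply: He; exact: ballxx.
  pose d := Num.min (e / 2) (r - m).
  have d0 : 0 < d by rewrite lt_min divr_gt0//= subr_gt0.
  have de : d <= e / 2 by rewrite ge_min lexx.
  have dr : d <= r - m by rewrite ge_min lexx orbT.
  exists (geodesic x xi (m + d)); split.
    split; first exact: Hg.
    move=> Od; have : S (m + d) by split => //; apply/andP; split; lra.
    by move/Sm; lra.
  by apply: He; rewrite /ball/= opprD addNKr normrN gtr0_norm; lra.
Qed.

End Distance.

(** * The Funk distance *)

Section FunkDistance.
Context {R : realType} {n : nat}.
Local Notation V := 'rV[R]_n.+1.
Local Notation H := (@hyperboloid R n).
Local Notation mu := (@lebesgue_measure R).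
Variable Omega : set V.
Hypothesis Omega_open : hopen Omega.
Hypothesis Omega_convex : hconvex Omega.
Variable p : V -> V -> R.
Hypothesis p_ray : forall x xi, Omega x -> tangent x xi ->
  p x xi = minkowski_ray Omega x xi.
Hypothesis p_eta : forall x xi, Omega x -> tangent x xi ->
  p x xi = minkowski_eta Omega x xi.
Implicit Types (x y z xi v w u : V) (a b s t r L D : R) (c : R -> V).

Lemma continuous_coth_segment L D : L < D ->
  {within `[0, L], continuous (fun t => cosh (D - t) / sinh (D - t))}.
Proof.
move=> LD; have cB t : {for t, continuous (fun s : R => D - s)}.
  by apply: cvgB; [exact: cvg_cst|exact: cvg_id].
apply: continuous_in_subspaceT => t; rewrite inE/= in_itv/= => /andP[t0 tL].
apply: cvgM; first exact: (continuous_comp (cB t) (@continuous_cosh R _)).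
apply: cvgV; first by rewrite gt_eqF// sinh_gt0//; lra.
exact: (continuous_comp (cB t) (@continuous_sinh R _)).
Qed.

Lemma integral_coth L D : 0 < L -> L < D ->
  (\int[mu]_(t in `[0%R, L]) (cosh (D - t) / sinh (D - t))%:E =
   (ln (sinh D) - ln (sinh (D - L)))%:E)%E.
Proof.
move=> L0 LD; pose G t := - ln (sinh (D - t)).
have sD t : t \in `[0, L] -> 0 < sinh (D - t).
  by rewrite in_itv/= => /andP[h1 h2]; apply: sinh_gt0; lra.
have dG t : t \in `[0, L] -> is_derive t (1 : R) G (cosh (D - t) / sinh (D - t)).
  move=> tL.
  have d1 : is_derive t (1 : R) (fun s => D - s) (- 1).
    have -> : (fun s => D - s) = cst D - @id R by apply/funext.
    by apply: is_derive_eq; rewrite sub0r.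
  have d2 := @is_derive1_comp _ (@sinh R) (fun s => D - s) t _ _ (is_derive_sinh _) d1.
  have d3 := @is_derive1_comp _ (@ln R) (fun s => sinh (D - s)) t _ _
    (is_derive1_ln (sD t tL)) d2.
  have := is_deriveN d3 => h; apply: (is_derive_eq h).
  by rewrite mulrN1 mulrN opprK mulrC.
have cG t : t \in `[0, L] -> {for t, continuous G}.
  move=> tL; apply/differentiable_continuous/derivable1_diffP.
  by have [] := dG t tL.
have ccoth := continuous_coth_segment LD.
rewrite (@continuous_FTC2 R _ G _ _ L0 ccoth).
- by rewrite -EFinB /G subr0 opprK addrC.
- split.
  + by move=> t /subset_itv_oo_cc tL; have [] := dG t tL.
  + by apply: cvg_at_right_filter; apply: cG; rewrite in_itv/= lexx ltW.
  + by apply: cvg_at_left_filter; apply: cG; rewrite in_itv/= lexx ltW.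
- move=> t /subset_itv_oo_cc tL; rewrite derive1E.
  by apply: derive_val; exact: dG.
Qed.

Lemma finsler_dist_ge0 x y : (0 <= finsler_dist Omega p x y)%E.
Proof.
apply: le_ereal_inf_tmp => _ [a [b [c [ab pc Oc _ ->]]]].
apply: integral_ge0 => t tab; rewrite lee_fin.
exact: (curve_density_ge0 Omega_open p_ray ab Oc).
Qed.

Lemma finsler_dist_refl x : Omega x -> finsler_dist Omega p x x = 0%E.
Proof.
move=> Ox; apply/eqP; rewrite eq_le finsler_dist_ge0 andbT.
have p0 : p x 0 = 0.
  have tx : tangent x 0 by rewrite /tangent/= lorentz0r.
  apply/eqP; rewrite p_ray// eq_le minkowski_ray_ge0// andbT.
  apply: minkowski_ray_le => // v _.
  by rewrite /funk_form lorentz0r oppr0 mul0r hnorm0 ltxx.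
apply: ereal_inf_lbound; exists 0, 1, (cst x); split => //.
- split; first by apply: continuous_subspaceT => ?; exact: cvg_cst.
  exists [:: 1]; split => //=; first by rewrite ltr01.
  move=> [|//] _ /=.
  have d0 : derive1 (cst x) = cst (0 : V) :> (R -> V).
    by apply/funext => t; rewrite derive1_cst.
  rewrite /C1_piece d0; split.
  + by move=> t _; exact: derivable_cst.
  + by move=> t _; exact: cvg_cst.
  + exact: is_cvg_cst.
  + exact: is_cvg_cst.
- by apply/esym/integral0_eq => t _; rewrite derive1_cst /= p0.
Qed.

Lemma finsler_dist_le_geodesic x xi L : 0 < L ->
  {in `[0, L], forall t, Omega (geodesic x xi t)} ->
  (finsler_dist Omega p x (geodesic x xi L) <=
   \int[mu]_(t in `[0%R, L])
     (p (geodesic x xi t) (derive1 (geodesic x xi) t))%:E)%E.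
Proof.
move=> L0 Og; apply: ereal_inf_lbound; exists 0, L, (geodesic x xi); split => //.
  exact: C1_geodesic.
by split => //; rewrite /geodesic cosh0 sinh0 scale1r scale0r addr0.
Qed.

Section Segment.
Variables (x xi : V) (L : R).
Hypothesis (Ox : Omega x) (txi : tangent x xi) (xi1 : hnorm xi = 1).
Hypothesis (L0 : 0 < L) (Og : {in `[0, L], forall t, Omega (geodesic x xi t)}).
Local Notation c := (geodesic x xi).

Let Hx : H x := hopen_subset Omega_open Ox.

Lemma geodesic_frame t :
  [/\ H (c t), tangent (c t) (derive1 c t), hnorm (derive1 c t) = 1 &
      forall s, c (t + s) = cosh s *: c t + sinh s *: derive1 c t].
Proof.
rewrite derive1_geodesic; have [? ? ?] := geodesic_velocity t Hx txi xi1.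
by split => // s; exact: geodesic_shift.
Qed.

Lemma hdist_geodesic s t : s <= t -> hdist (c s) (c t) = t - s.
Proof.
move=> st; have [Hc tc c1 cE] := geodesic_frame s.
rewrite -{1}(subrKC s t) cE -hexp_unit// hdist_unit//.
by rewrite subr_ge0.
Qed.

(** A ray that meets no boundary point stays in [Omega], hence meets no
    supporting hyperplane, and the density vanishes along it. *)
Lemma finsler_dist_no_exit : ~ (hray x xi `&` hboundary Omega !=set0) ->
  finsler_dist Omega p x (c L) = 0%E.
Proof.
move=> noexit; apply/eqP; rewrite eq_le finsler_dist_ge0 andbT.
apply: (le_trans (finsler_dist_le_geodesic L0 Og)).
rewrite integral0_eq// => t tL; have Oct := Og tL.
have [Hc tc c1 cE] := geodesic_frame t.
congr EFin; apply/eqP; rewrite p_ray// eq_le minkowski_ray_ge0// andbT.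
apply: minkowski_ray_le => // v nv hq; exfalso.
have [z [[s s0 zE] [_ vz]]] :=
  hray_meets_hyperplane Hc tc (lorentz_normal_gt0 Oct nv) hq.
rewrite /= in s0; rewrite hexp_unit// -cE in zE.
apply: noexit; apply: (ray_exits Omega_open Ox txi xi1 (r := t + s)).
  by move: tL; rewrite /= in_itv/= => /andP[? _]; lra.
by move=> /lorentz_normal_gt0/(_ nv); rewrite zE vz ltxx.
Qed.

Section Exit.
Variable D : R.
Hypothesis (D0 : 0 < D) (bD : hboundary Omega (c D)).

Lemma lorentz_geodesic_zero v t : lorentz v (c D) = 0 ->
  lorentz v (c t) = lorentz v x * (sinh (D - t) / sinh D).
Proof.
have sD := sinh_gt0 D0.
rewrite /geodesic sinhB !lorentzE => vD.
have -> : lorentz v xi = - (cosh D * lorentz v x / sinh D).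
  move/eqP: vD; rewrite addrC addr_eq0 => /eqP vD.
  by rewrite -mulNr -vD; field; rewrite gt_eqF.
by field; rewrite gt_eqF.
Qed.

Lemma exit_normal : exists2 v, supporting_normal Omega v & lorentz v (c D) = 0.
Proof.
have [HD _ _ _] := geodesic_frame D.
have [v [vv vD Ov]] := supporting_normal_exists Omega_open Omega_convex Ox HD
  (hboundary_notin Omega_open bD).
by exists v => //; split => //; exists (c D).
Qed.

Lemma exit_after : L < D.
Proof.
have [v nv vD] := exit_normal.
have OL : Omega (c L) by apply: Og; rewrite in_itv/= lexx ltW.
have := lorentz_normal_gt0 OL nv; rewrite (lorentz_geodesic_zero _ vD).
rewrite pmulr_rgt0 ?(lorentz_normal_gt0 Ox nv)//.
by rewrite pmulr_lgt0 ?invr_gt0 ?sinh_gt0E// subr_gt0.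
Qed.

(** Every supporting hyperplane met by the ray is met at [c D] or later, since
    [c D] is in the closure of [Omega]. *)
Lemma density_geodesic_le t : t \in `[0, L] ->
  p (c t) (derive1 c t) <= cosh (D - t) / sinh (D - t).
Proof.
move=> tL; have Oct := Og tL; have [Hc tc c1 cE] := geodesic_frame t.
have Dt : 0 < D - t.
  by move: tL exit_after; rewrite in_itv/= => /andP[? ?]; lra.
have sDt := sinh_gt0 Dt.
rewrite p_ray//; apply: minkowski_ray_le => //.
  by rewrite divr_ge0// ltW// cosh_gt0.
move=> v nv _; have vc := lorentz_normal_gt0 Oct nv.
have [_ Ov _] := nv; have : 0 <= lorentz v (c D).
  by apply: (halfspace_closure Ov); case: bD => -[].
have -> : c D = cosh (D - t) *: c t + sinh (D - t) *: derive1 c t.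
  by rewrite -cE subrKC.
rewrite lorentzDr (lorentzZr (cosh _)) (lorentzZr (sinh _)) => h.
rewrite /funk_form ler_pdivrMr// mulrAC ler_pdivlMr//; lra.
Qed.

Lemma finsler_dist_exit : finsler_dist Omega p x (c L) =
  (ln (sinh D / sinh (D - L)))%:E.
Proof.
have LD := exit_after; have DL : 0 < D - L by rewrite subr_gt0.
have sD := sinh_gt0 D0; have sDL := sinh_gt0 DL.
rewrite ln_div ?posrE//.
apply/eqP; rewrite eq_le; apply/andP; split.
- apply: (le_trans (finsler_dist_le_geodesic L0 Og)).
  rewrite -integral_coth//.
  have mp := curve_density_measurable Omega_open p_eta L0 (C1_geodesic x xi L0) Og.
  apply: ge0_le_integral => //.
  + move=> t tL; rewrite lee_fin.
    exact: (curve_density_ge0 Omega_open p_ray L0 Og).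
  + exact/measurable_EFinP.
  + apply/measurable_EFinP; apply: subspace_continuous_measurable_fun => //.
    exact: continuous_coth_segment.
  + by move=> t tL; rewrite lee_fin; exact: density_geodesic_le.
- apply: le_ereal_inf_tmp => _ [a [b [g [ab pg Og' [ga gb] ->]]]].
  have [v nv vD] := exit_normal.
  have := curve_length_ge Omega_open p_ray p_eta ab pg Og' nv; rewrite ga gb.
  congr (_ <= _)%E; congr EFin; rewrite (lorentz_geodesic_zero _ vD).
  have vx := lorentz_normal_gt0 Ox nv.
  have lnq : ln (sinh (D - L) / sinh D) = ln (sinh (D - L)) - ln (sinh D).
    by rewrite ln_div ?posrE.
  have q0 : 0 < sinh (D - L) / sinh D by rewrite divr_gt0.
  by rewrite lnM ?posrE// lnq; ring.
Qed.

End Exit.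
End Segment.

Lemma funk_finsler_dist x y : Omega x -> Omega y ->
  (funk Omega x y)%:E = finsler_dist Omega p x y.
Proof.
move=> Ox Oy; have [Hx Hy] := (hopen_subset Omega_open Ox, hopen_subset Omega_open Oy).
have [xy|xy] := pselect (x = y).
  by rewrite -xy finsler_dist_refl// /funk; case: asboolP => // -[].
have [txi xi1 yE] := directionP Hx Hy xy.
have L0 := hdist_gt0 Hx Hy xy.
set L := hdist x y in L0 yE; have cE t : hexp x (t *: direction x y) =
  geodesic x (direction x y) t by exact: hexp_unit.
have Og : {in `[0, L], forall t, Omega (geodesic x (direction x y) t)}.
  by move=> t; rewrite in_itv/= -cE => tL; exact: Omega_convex.
have yc : geodesic x (direction x y) L = y by rewrite -cE.
rewrite -[in RHS]yc /funk; case: asboolP => [[_ ne]|nexit]; last first.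
  rewrite finsler_dist_no_exit// => ne; exact: nexit.
have [[D /= D0 zE] bz] : (ray_through x y `&` hboundary Omega) (exit_point Omega x y).
  exact: xgetPex.
rewrite -zE cE in bz *; have LD := exit_after Ox txi xi1 L0 Og D0 bz.
rewrite (finsler_dist_exit Ox txi xi1 L0 Og D0 bz).
have g0 : geodesic x (direction x y) 0 = x.
  by rewrite /geodesic cosh0 sinh0 scale1r scale0r addr0.
congr (ln (sinh _ / sinh _))%:E.
  by rewrite -{1}g0 hdist_geodesic ?subr0// ltW.
by rewrite -{1}yc hdist_geodesic// ltW.
Qed.

End FunkDistance.

Theorem theorem3p7 (R : realType) (n : nat) (Omega : set 'rV[R]_n.+1)
  (Omega_open : hopen Omega) (Omega_convex : hconvex Omega) :
  (forall x xi : 'rV[R]_n.+1, Omega x -> tangent x xi ->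
     (exists2 pi, supporting Omega pi & hray x xi `&` pi !=set0) ->
     minkowski_ray Omega x xi = minkowski_eta Omega x xi) /\
  (forall p : 'rV[R]_n.+1 -> 'rV[R]_n.+1 -> R,
     (forall x xi, Omega x -> tangent x xi -> p x xi = minkowski_ray Omega x xi) ->
     (forall x xi, Omega x -> tangent x xi -> p x xi = minkowski_eta Omega x xi) ->
     forall x y, Omega x -> Omega y ->
       (funk Omega x y)%:E = finsler_dist Omega p x y).
Proof.
split; first by move=> x xi Ox; exact: minkowski_ray_eta.
by move=> p p_ray p_eta x y; exact: funk_finsler_dist.
Qed.
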